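(* Let $b\in\{N,D\}$. Let $\mu$ be a non-atomic Borel probability measure on $[0,1]$ with $0,1\in\operatorname{supp}(\mu)$, and let $(\mu_n)_{n\in\mathbb{N}}$ be a sequence of non-atomic Borel probability measures on $[0,1]$ with $0,1\in\operatorname{supp}(\mu_n)$ and $\operatorname{supp}(\mu)\subseteq\operatorname{supp}(\mu_n)$ for all $n$, such that $\mu_n$ converges weakly to $\mu$ as $n\to\infty$. Let $\lambda>0$, $R_\lambda^b=(\lambda-\Delta_\mu^b)^{-1}$ and $R_{\lambda,n}^b=(\lambda-\Delta_{\mu_n}^b)^{-1}$, and let $\pi_n:(C[0,1])_\mu^b\to(C[0,1])_{\mu_n}^b$ be the embedding. Then for all $f\in(C[0,1])_\mu^b$, $$\lim_{n\to\infty}\left\lVert R_{\lambda,n}^b\pi_n f-\pi_n R_\lambda^b f\right\rVert_\infty=0.$$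
   Context: For a non-atomic Borel probability measure $\nu$ on $[0,1]$ with $0,1\in\operatorname{supp}(\nu)$: Let $\mathcal{D}_\nu^2$ be the set of $f\in C^1([0,1])$ for which there is $(f')^\nu\in L^2([0,1],\nu)$ with $f'(x)=f'(0)+\int_0^x (f')^\nu\,d\nu$ for all $x\in[0,1]$. The Krein-Feller operators $\Delta_\nu^N$ (Neumann) and $\Delta_\nu^D$ (Dirichlet) on $L^2([0,1],\nu)$ are given by $f\mapsto(f')^\nu$ (computed from the representative in $\mathcal{D}_\nu^2$), with domains: $\mathcal{D}(\Delta_\nu^N)$ is the set of $f\in L^2([0,1],\nu)$ having a representative $\bar f\in\mathcal{D}_\nu^2$ with $\bar f'(0)=\bar f'(1)=0$; $\mathcal{D}(\Delta_\nu^D)$ is the set of $f\in L^2([0,1],\nu)$ having a representative $\bar f\in\mathcal{D}_\nu^2$ with $\bar f(0)=\bar f(1)=0$. Both operators are self-adjoint and non-positive, so $(\lambda-\Delta_\nu^b)^{-1}$ is a bounded operator on $L^2([0,1],\nu)$ for $\lambda>0$. $(C[0,1])_\nu^N$ is the set of elements of $L^2([0,1],\nu)$ having a continuous representative on $[0,1]$; $(C[0,1])_\nu^D$ is the set of those having a continuous representative $\bar f$ with $\bar f(0)=\bar f(1)=0$. Each is a Banach space with norm $\lVert f\rVert_\infty:=\sup_{x\in\operatorname{supp}(\nu)}|\bar f(x)|$, $\bar f$ a continuous representative; equivalently, the sup norm over $[0,1]$ of the continuous representative that is linear on every interval contained in $[0,1]\setminus\operatorname{supp}(\nu)$. One has $\mathcal{D}(\Delta_\nu^b)\subseteq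 (C[0,1])_\nu^b$. The norm in the claim is that of $(C[0,1])_{\mu_n}^b$. When $\operatorname{supp}(\mu)\subseteq\operatorname{supp}(\mu_n)$, the embedding $\pi_n:(C[0,1])_\mu^b\to(C[0,1])_{\mu_n}^b$ sends $f$ to the $L^2([0,1],\mu_n)$-equivalence class of the continuous representative of $f$ that is linear on every interval contained in $[0,1]\setminus\operatorname{supp}(\mu)$. *)

(* Defs.v *)
From HB Require Import structures.
From mathcomp Require Import all_boot all_order all_algebra generic_quotient.
From mathcomp Require Import all_classical all_reals all_analysis measurable_realfun.

Set Implicit Arguments.
Unset Strict Implicit.
Unset Printing Implicit Defensive.

Import Order.TTheory GRing.Theory Num.Theory.
Import numFieldNormedType.Exports.

Local Open Scope classical_set_scope.
Local Open Scope ring_scope.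

(* A Borel probability measure on [0,1] is encoded as a Borel probability
   measure on the line that gives mass 1 to [0,1]; a function on [0,1] is
   encoded as a function on the line, whose values off [0,1] play no role. *)

Section measures.
Context {R : realType}.
Implicit Type nu : probability (measurableTypeR R) R.

Definition on_unit_interval nu := nu `[0, 1]%classic = 1%E.

(* Every atom of a finite Borel measure on the line carries a point mass. *)
Definition non_atomic nu := forall x : R, nu [set x] = 0%E.

Definition supp nu : set R :=
  [set x | forall U : set R, open U -> U x -> (0 < nu U)%E].

Definition converges_weakly (nus : nat -> probability (measurableTypeR R) R) nu :=
  forall g : R -> R, {within `[0, 1], continuous g} ->
    \int[nus n]_(x in `[0, 1]) g x @[n --> \oo] -->
    \int[nu]_(x in `[0, 1]) g x.

End measures.

Section L2.
Context {R : realType}.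
Variable nu : probability (measurableTypeR R) R.

Definition L2 := LspaceType nu (lee1n 2).

HB.instance Definition _ := gen_eqMixin L2.
HB.instance Definition _ := gen_choiceMixin L2.

Definition L2_fun (u : L2) : R -> R := u.
Coercion L2_fun : L2 >-> Funclass.

Let T := measurableTypeR R.

Section class_of.
Variables (g : T -> T) (mg : measurable_fun [set: T] g).
Hypothesis fg : finite_norm nu 2%:R%:E (g : T -> R).

Let gm : {mfun T >-> T} := HB.pack g (isMeasurableFun.Build _ _ _ _ g mg).
Let q : {mfun_ nu, T >-> T} := (\pi gm)%qT.

Let q_ae : (q : T -> T) = g %[ae nu].
Proof.
have : (repr q == gm %[mod {mfun_ nu, T >-> T}])%qT by rewrite reprK.
by rewrite eqmodE => /asboolP.
Qed.

Let q_fin : finite_norm nu 2%:R%:E (q : T -> R).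
Proof.
have mabs (h : {mfun T >-> T}) :
    measurable_fun [set: T]
      ((@poweR R ^~ 2%:R) \o (abse \o (EFin \o (h : T -> R)))).
  apply: measurableT_comp; first exact: measurable_poweR.
  apply: measurableT_comp => //; apply/measurable_EFinP.
  exact: (measurable_funPT h).
apply: le_lt_trans fg; rewrite le_eqVlt; apply/orP; left; apply/eqP.
rewrite unlock; congr (_ `^ _)%E; apply: ge0_ae_eq_integral => //.
- exact: (mabs (repr q)).
- exact: (mabs gm).
- by move=> x _; exact: poweR_ge0.
- by move=> x _; exact: poweR_ge0.
- have [N [mN N0 sub]] := q_ae; exists N; split=> // x nx; apply: sub => qg.
  by apply: nx => _ /=; rewrite (qg I).
Qed.

Definition L2_of : L2 := HB.pack q (isFinLebesgue.Build _ _ _ _ _ _ q q_fin).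

Lemma L2_ofE : (L2_of : R -> R) = g %[ae nu].
Proof. exact: q_ae. Qed.
End class_of.

Definition L2_0 : L2 :=
  @L2_of (cst (0 : R)) (measurable_cst _) (finite_norm_cst0 nu (lee1n 2)).

Definition L2_class (g : R -> R) : L2 :=
  xget L2_0 [set u : L2 | (u : R -> R) = g %[ae nu]].

Lemma L2_classE (g : R -> R) :
  (exists u : L2, (u : R -> R) = g %[ae nu]) ->
  (L2_class g : R -> R) = g %[ae nu].
Proof. by rewrite /L2_class; case: xgetP => // noclass [u /noclass]. Qed.

Lemma L2_eqP (u v : L2) : (u : R -> R) = v %[ae nu] <-> u = v.
Proof.
split=> [|->]; last exact: ae_eq_refl.
case: u v => [u [[ufin]]] [v [[vfin]]] /= uv.
have uvE : u = v.
  by rewrite -[u]reprK -[v]reprK; apply/eqmodP/asboolP.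
by subst v; rewrite (Prop_irrelevance ufin vfin).
Qed.

(* The library has no vector space structure on its Lp spaces. *)
Definition L2_sub (u v : L2) : L2 := L2_class (fun x => u x - v x).

Definition L2_scale (a : R) (u : L2) : L2 := L2_class (fun x => a * u x).

Lemma L2_Lfun (u : L2) : (u : R -> R) \in Lfun nu 2%:R%:E.
Proof.
apply/andP; rewrite !inE; split; last exact: Lebesgue_finite.
exact: (@measurable_funPT _ _ T T (repr (u : {mfun_ nu, T >-> T}))).
Qed.

Lemma L2_classP (g : R -> R) : g \in Lfun nu 2%:R%:E ->
  (L2_class g : R -> R) = g %[ae nu].
Proof.
move=> /andP[]; rewrite !inE => mg fg.
apply: L2_classE; exists (@L2_of g mg fg).
exact: (@L2_ofE g mg fg).
Qed.

Lemma L2_subE (u v : L2) :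
  (L2_sub u v : R -> R) = (fun x => u x - v x) %[ae nu].
Proof.
apply: L2_classP; have [_ comb] := Lfun_submod_closed nu (lee1n 2).
rewrite (_ : (fun _ => _) = (-1) *: (v : R -> R) + (u : R -> R)).
  by apply: comb; exact: L2_Lfun.
by apply/funext => x; rewrite !fctE scaleN1r addrC.
Qed.

Lemma L2_scaleE (a : R) (u : L2) :
  (L2_scale a u : R -> R) = (fun x => a * u x) %[ae nu].
Proof.
apply: L2_classP; have [zero comb] := Lfun_submod_closed nu (lee1n 2).
rewrite (_ : (fun _ => _) = a *: (u : R -> R) + 0).
  by apply: comb => //; exact: L2_Lfun.
by rewrite addr0.
Qed.

End L2.

Inductive boundary := Neumann | Dirichlet.

Section krein_feller.
Context {R : realType}.
Implicit Types (nu mu : probability (measurableTypeR R) R) (f df : R -> R).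

(* f is C^1 on [0,1] with derivative df, one-sided at the end points. *)
Definition is_C1 f df :=
  {within `[0, 1], continuous df} /\
  forall x, x \in `[0, 1] ->
    (f y - f x) / (y - x) @[y --> within `[0, 1]%classic x^'] --> df x.

(* f is in D_nu^2, with derivative df and nu-density v of df. *)
Definition D2 nu f df (v : L2 nu) :=
  is_C1 f df /\
  forall x, x \in `[0, 1] -> df x = df 0 + \int[nu]_(t in `[0, x]) v t.

Definition boundary_condition (b : boundary) f df :=
  match b with
  | Neumann => df 0 = 0 /\ df 1 = 0
  | Dirichlet => f 0 = 0 /\ f 1 = 0
  end.

(* The graph of the operator: u is in the domain and is mapped to v. *)
Definition Delta nu (b : boundary) (u v : L2 nu) :=
  exists f df, [/\ (u : R -> R) = f %[ae nu], D2 f df v &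
                   boundary_condition b f df].

(* For nu non-atomic on [0,1] with 0 and 1 in its support, lambda > 0 and
   u in Cspace, the sets passed to xget below are inhabited, so the defaults
   are not used: there is one resolvent, and the representatives are determined
   on the support (gap_linear_rep: on [0,1]). *)
Definition resolvent nu (b : boundary) (lambda : R) (f : L2 nu) : L2 nu :=
  xget (L2_0 nu)
    [set u | exists2 v, Delta b u v & L2_sub (L2_scale lambda u) v = f].

Definition continuous_rep nu (u : L2 nu) : set (R -> R) :=
  [set g : R -> R | {within `[0, 1], continuous g} /\ (u : R -> R) = g %[ae nu]].

Definition Cspace (b : boundary) nu : set (L2 nu) :=
  [set u | exists2 g : R -> R, continuous_rep u g &
             b = Dirichlet -> g 0 = 0 /\ g 1 = 0].

(* The value is +oo off Cspace, so that finiteness includes membership. *)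
Definition Cnorm nu (b : boundary) (u : L2 nu) : \bar R :=
  if u \in @Cspace b nu then
    ereal_sup [set `|xget (cst 0) (continuous_rep u) x|%:E | x in supp nu]
  else +oo%E.

Definition linear_on_gaps nu (g : R -> R) :=
  forall i : interval R, [set` i] `<=` `[0, 1]%classic `\` supp nu ->
    exists a c : R, forall x, x \in i -> g x = a * x + c.

Definition gap_linear_rep nu (u : L2 nu) : R -> R :=
  xget (cst 0) (continuous_rep u `&` [set g | linear_on_gaps nu g]).

Definition embedding mu nu (u : L2 mu) : L2 nu :=
  L2_class nu (gap_linear_rep u).

End krein_feller.

Arguments Cspace {R} b nu.

(* Main.v *)
Require Import Defs.
From mathcomp Require Import all_boot all_order all_algebra.
From mathcomp Require Import all_classical all_reals all_analysis.
From mathcomp Require Import measurable_realfun ring lra.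

Set Implicit Arguments.
Unset Strict Implicit.
Unset Printing Implicit Defensive.

Import Order.TTheory GRing.Theory Num.Theory.
Import numFieldNormedType.Exports.

Local Open Scope classical_set_scope.
Local Open Scope ring_scope.

(** Let g be the gap-linear representative of f, and let u and u_n be the C1
    representatives of the resolvents of f and of its embedding, with respect
    to mu and mu_n. The function u satisfies
      u'(x) = u'(0) + \int_[0,x] (lambda u - g) dmu,
    and u_n satisfies the same equation with mu_n; the boundary conditions are
    the same. Put h = lambda u - g and
      e_n(x) = \int (x - t)^+ h(t) dmu_n(t) - \int (x - t)^+ h(t) dmu(t).
    As the measures have no atoms, e_n is C1 with derivative
    \int_[0,x] h dmu_n - \int_[0,x] h dmu ([potential_C1]). Hence
    W = u_n - u - e_n satisfies
      W'(x) = W'(0) + \int_[0,x] lambda (W + e_n) dmu_n,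
    and the maximum principle bounds |W| by sup |e_n| ([max_principle]). In the
    Neumann case W'(1) does not vanish, and h is first replaced by h - c_n in
    the integral against mu_n, where c_n = \int h dmu_n tends to
    \int h dmu = u'(1) - u'(0) = 0 ([stability]).

    The function t |-> (x - t)^+ h(t) is continuous, so weak convergence gives
    e_n(x) --> 0 for every x. The e_n are Lipschitz with a common constant,
    so the convergence is uniform ([potential_cvg]), and u_n tends to u
    uniformly on [0,1] ([resolvent_cvg]).

    That the resolvents have such representatives requires solving the boundary
    value problem for a continuous right-hand side: a Volterra equation is
    solved by monotone Picard iteration ([volterra]), and shooting adjusts the
    boundary values ([solution_exists]).

    It remains to pass between classes and functions. Continuous functions that
    are equal almost everywhere agree on the support ([ae_eq_supp]), a solution
    is linear on the gaps ([solves_linear_on_gaps]), and a continuous function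
    linear on the gaps is determined by its values on the support
    ([gap_unique]); so the embedding of the resolvent of f is the class of u.
    Interpolation across the gaps shows that gap-linear representatives exist
    ([interpolate_continuous]). *)

(** * Calculus on the unit interval *)

Section calculus.
Context {R : realType}.
Implicit Types (f df g dg h : R -> R) (x y a c e : R).

Lemma within_continuousP g : {within `[0, 1], continuous g} <->
  forall x, 0 <= x <= 1 -> forall e, 0 < e -> exists2 d, 0 < d &
    forall y, 0 <= y <= 1 -> `|y - x| < d -> `|g y - g x| < e.
Proof.
rewrite subspace_continuousP; split=> cg x x01.
  have xI : `[0, 1]%classic x by rewrite /= in_itv.
  move=> e e0; have /cvgrPdist_lt/(_ e e0) := cg x xI.
  rewrite near_withinE => /nbhs_ballP[d d0 h]; exists d => // y y01 yx.
  rewrite distrC; apply: (h y); last by rewrite /= in_itv.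
  by rewrite /ball /= distrC.
have {}x01 : 0 <= x <= 1 by move: x01; rewrite /= in_itv.
apply/cvgrPdist_lt => e e0; have [d d0 h] := cg x x01 e e0.
rewrite near_withinE; apply/nbhs_ballP; exists d => // y /= xy.
by rewrite in_itv /= => y01; rewrite distrC h// distrC.
Qed.

(** The difference quotient cleared of its denominator; the point y = x need
    not be excluded. *)
Lemma is_C1P f df : is_C1 f df <->
  {within `[0, 1], continuous df} /\
  forall x, 0 <= x <= 1 -> forall e, 0 < e -> exists2 d, 0 < d &
    forall y, 0 <= y <= 1 -> `|y - x| < d ->
      `|f y - f x - df x * (y - x)| <= e * `|y - x|.
Proof.
split=> -[cdf h]; split=> // x x01.
  move=> e e0; have {}x01 : x \in `[0, 1] by rewrite in_itv.
  have /cvgrPdist_lt/(_ e e0) := h x x01.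
  rewrite near_withinE near_withinE => /nbhs_ballP[d d0 {}h].
  exists d => // y y01 yx; have [->|nyx] := eqVneq y x.
    by rewrite !subrr mulr0 subrr normr0 mulr0.
  have := h y; rewrite /ball /= distrC => /(_ yx nyx).
  rewrite in_itv /= => /(_ y01)/ltW.
  rewrite -(@ler_pM2r _ `|y - x|) ?normr_gt0 ?subr_eq0// -normrM.
  by rewrite mulrBl divfK ?subr_eq0// distrC.
move: x01; rewrite in_itv /= => x01.
apply/cvgrPdist_le => e e0; have [d d0 {}h] := h x x01 e e0.
rewrite !near_withinE; apply/nbhs_ballP; exists d => // y /= xy nyx.
rewrite in_itv /= => y01.
rewrite -(@ler_pM2r _ `|y - x|) ?normr_gt0 ?subr_eq0// -normrM.
by rewrite mulrBl divfK ?subr_eq0// distrC h// distrC.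
Qed.

Lemma within_continuous_lin g h a c :
  {within `[0, 1], continuous g} -> {within `[0, 1], continuous h} ->
  {within `[0, 1], continuous (fun x => a * g x + c * h x)}.
Proof.
move=> cg ch; apply: (@within_continuousD _ R R _
  (fun x => a * g x) (fun x => c * h x)) => x.
  by apply: cvgM; [exact: cvg_cst|exact: cg].
by apply: cvgM; [exact: cvg_cst|exact: ch].
Qed.

Lemma within_continuous_cst a : {within `[0, 1], continuous (cst a : R -> R)}.
Proof. by move=> x; exact: cvg_cst. Qed.

Lemma is_C1_lin f df g dg a c : is_C1 f df -> is_C1 g dg ->
  is_C1 (fun x => a * f x + c * g x) (fun x => a * df x + c * dg x).
Proof.
move=> [cdf hf] [cdg hg]; split; first exact: within_continuous_lin.
move=> x x01.
rewrite (_ : (fun y => _) = (fun y =>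
  a * ((f y - f x) / (y - x)) + c * ((g y - g x) / (y - x)))).
  by apply: cvgD; (apply: cvgM; [exact: cvg_cst|by [exact: hf|exact: hg]]).
by apply/funext => y; ring.
Qed.

Lemma is_C1_affine a c : is_C1 (fun x => a + c * x) (fun=> c).
Proof.
apply/is_C1P; split=> [|x x01 e e0]; first exact: within_continuous_cst.
exists 1 => // y _ _; rewrite (_ : _ - _ = 0); last by ring.
by rewrite normr0 mulr_ge0// ltW.
Qed.

Lemma is_C1_continuous f df : is_C1 f df -> {within `[0, 1], continuous f}.
Proof.
move=> /is_C1P[_ h]; apply/within_continuousP => x x01 e e0.
have [d d0 {}h] := h x x01 1 ltr01.
pose k := 2 + `|df x|; have k0 : 0 < k by rewrite ltr_pwDl.
exists (Num.min d (e / k)); first by rewrite lt_min d0 divr_gt0.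
move=> y y01; rewrite lt_min => /andP[yd yk].
have := h y y01 yd; rewrite mul1r => {}h.
rewrite (_ : f y - f x = (f y - f x - df x * (y - x)) + df x * (y - x));
  last by ring.
have yke : k * `|y - x| < e by rewrite mulrC -ltr_pdivlMr.
apply: le_lt_trans yke; apply: le_trans (ler_normD _ _) _.
rewrite normrM /k mulrDl lerD2r (le_trans h)//.
by rewrite ler_peMl// ler1n.
Qed.

Lemma is_C1_MVT f df x y : is_C1 f df -> 0 <= x -> x < y -> y <= 1 ->
  exists2 z, x < z < y & f y - f x = df z * (y - x).
Proof.
move=> Cf x0 xy y1.
have [_ h] := Cf.
have sub : `[x, y] `<=` (`[0, 1]%classic : set R).
  by apply: subset_itv; rewrite bnd_simp.
have [z||z zxy fxy] := @MVT R f df x y xy.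
- rewrite in_itv /= => /andP[xz zy].
  have z0 : 0 < z by exact: le_lt_trans xz.
  have z1 : z < 1 by exact: lt_le_trans y1.
  have z01 : z \in `[0, 1] by rewrite in_itv /= !ltW.
  have [_ /is_C1P[_ hz]] := (I, Cf).
  have h0 : h^-1 *: ((f \o shift z) (h *: (1 : R)) - f z) @[h --> 0^'] --> df z.
    apply/cvgrPdist_le => e e0.
    have [d d0 {}hz] := hz z (introT andP (conj (ltW z0) (ltW z1))) e e0.
    rewrite near_withinE; apply/nbhs_ballP.
    exists (Num.min d (Num.min z (1 - z))).
      by rewrite /= !lt_min d0 z0 subr_gt0.
    move=> u; rewrite /ball /= sub0r normrN !lt_min => /and3P[ud uz uz1] nu.
    rewrite -(@ler_pM2r _ `|u|) ?normr_gt0// -normrM /shift /= [_ *: 1]mulr1.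
    rewrite mulrBl [_^-1 *: _]mulrC divfK// distrC.
    have := hz (u + z); rewrite addrK => /(_ _ ud); apply.
    by move: uz uz1; rewrite !ltr_norml => /andP[? ?] /andP[? ?]; lra.
  apply: DeriveDef; first by apply/cvg_ex; exists (df z).
  exact: cvg_lim h0.
- apply: continuous_subspaceW sub _; exact: is_C1_continuous Cf.
- by exists z; [move: zxy; rewrite in_itv|exact: fxy].
Qed.

Lemma is_C1_incr f df x y : is_C1 f df -> 0 <= x -> x <= y -> y <= 1 ->
  (forall z, x < z < y -> 0 <= df z) -> f x <= f y.
Proof.
move=> Cf x0; rewrite le_eqVlt => /predU1P[->//|xy] y1 df0.
have [z zxy fxy] := is_C1_MVT Cf x0 xy y1.
by rewrite -subr_ge0 fxy mulr_ge0 ?df0// subr_ge0 ltW.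
Qed.

End calculus.

(** * Integrals of bounded Borel functions over the unit interval *)

Section bounded_measurable.
Context {R : realType}.
Implicit Types (g k : R -> R) (x y t a c e M : R).
Implicit Type nu : probability (measurableTypeR R) R.
Let T := measurableTypeR R.

(** Borel and bounded on the unit interval; nothing is required outside. *)
Definition bounded_measurable k :=
  measurable_fun (`[0, 1]%classic : set T) (k : T -> T) /\
  exists M, forall t, 0 <= t <= 1 -> `|k t| <= M.

Lemma bounded_measurable_continuous k :
  {within `[0, 1], continuous k} -> bounded_measurable k.
Proof.
move=> ck; split; first exact: subspace_continuous_measurable_fun.
have [c _ cmax] := EVT_max (@ler01 R) ck.
have [d _ dmin] := EVT_min (@ler01 R) ck.
exists (`|k c| + `|k d|) => t t01.
have tI : t \in `[0, 1] by rewrite in_itv.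
have := cmax t tI; have := dmin t tI.
have := ler_norm (k c); have := ler_norm (- k d); rewrite normrN.
rewrite ler_norml; have := normr_ge0 (k c); have := normr_ge0 (k d).
lra.
Qed.

Lemma bounded_measurable_cst a : bounded_measurable (cst a).
Proof.
by apply: bounded_measurable_continuous; exact: within_continuous_cst.
Qed.

Lemma bounded_measurableM g k : bounded_measurable g -> bounded_measurable k ->
  bounded_measurable (fun t => g t * k t).
Proof.
move=> [mg [M gM]] [mk [N kN]]; split; first exact: measurable_funM.
exists (M * N) => t t01; rewrite normrM ler_pM//; [exact: gM|exact: kN].
Qed.

Lemma bounded_measurableD g k : bounded_measurable g -> bounded_measurable k ->
  bounded_measurable (fun t => g t + k t).
Proof.
move=> [mg [M gM]] [mk [N kN]]; split; first exact: measurable_funD.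
exists (M + N) => t t01; rewrite (le_trans (ler_normD _ _))// lerD//.
  exact: gM.
exact: kN.
Qed.

Lemma bounded_measurable_lin g k a c :
  bounded_measurable g -> bounded_measurable k ->
  bounded_measurable (fun t => a * g t + c * k t).
Proof.
move=> bg bk; apply: bounded_measurableD; apply: bounded_measurableM => //;
  exact: bounded_measurable_cst.
Qed.

(** The indicator of the half-line up to x, x included. *)
Definition below x t : R := (t <= x)%R%:R.

Lemma bounded_measurable_below x : bounded_measurable (below x).
Proof.
split; last by exists 1 => t _; rewrite /below; case: (t <= x);
  rewrite ?normr0 ?normr1.
rewrite (_ : below x = \1_`]-oo, x]).
  exact: measurable_indic.
by apply/funext => t; rewrite indicE /below mem_setE in_itv /=.
Qed.

Lemma bounded_measurable_integrable nu k : bounded_measurable k ->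
  nu.-integrable `[0, 1] (EFin \o k).
Proof.
move=> [mk [M kM]]; apply: measurable_bounded_integrable => //.
  exact: le_lt_trans (probability_le1 nu _) (ltry 1).
exists M; split; first exact: num_real.
move=> N MN t; rewrite /= in_itv /= => t01.
exact: le_trans (kM t t01) (ltW MN).
Qed.

Lemma int_lin nu g k a c : bounded_measurable g -> bounded_measurable k ->
  \int[nu]_(t in `[0, 1]) (a * g t + c * k t) =
  a * \int[nu]_(t in `[0, 1]) g t + c * \int[nu]_(t in `[0, 1]) k t.
Proof.
move=> bg bk; have bc := bounded_measurable_cst.
rewrite (@RintegralD _ _ _ nu `[0, 1]%classic (fun t => a * g t)
  (fun t => c * k t))//.
- by rewrite !RintegralZl//; exact: bounded_measurable_integrable.
- by apply: bounded_measurable_integrable;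
    exact: (bounded_measurableM (bc a) bg).
- by apply: bounded_measurable_integrable;
    exact: (bounded_measurableM (bc c) bk).
Qed.

Lemma int_le nu g k : bounded_measurable g -> bounded_measurable k ->
  (forall t, 0 <= t <= 1 -> g t <= k t) ->
  \int[nu]_(t in `[0, 1]) g t <= \int[nu]_(t in `[0, 1]) k t.
Proof.
move=> bg bk gk; apply: le_Rintegral => //.
- exact: bounded_measurable_integrable.
- exact: bounded_measurable_integrable.
Qed.

Lemma int_cst nu a : on_unit_interval nu -> \int[nu]_(_ in `[0, 1]) a = a.
Proof.
move=> n1; rewrite Rintegral_cst// -[RHS]mulr1; congr (_ * _).
by rewrite -[RHS]/(fine 1%E); congr fine.
Qed.

Lemma eq_int nu g k : (forall t, 0 <= t <= 1 -> g t = k t) ->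
  \int[nu]_(t in `[0, 1]) g t = \int[nu]_(t in `[0, 1]) k t.
Proof.
move=> gk; apply: eq_Rintegral => t; rewrite inE /= in_itv /=; exact: gk.
Qed.

Lemma int_norm_le nu g k : on_unit_interval nu ->
  bounded_measurable g -> bounded_measurable k ->
  (forall t, 0 <= t <= 1 -> `|g t| <= k t) ->
  `|\int[nu]_(t in `[0, 1]) g t| <= \int[nu]_(t in `[0, 1]) k t.
Proof.
move=> n1 bg bk gk; rewrite ler_norml; apply/andP; split; last first.
  by apply: int_le => // t /gk; rewrite ler_norml => /andP[].
rewrite -[leLHS]mulN1r -[leLHS]addr0.
rewrite -[X in _ + X](mul0r (\int[nu]_(t in `[0, 1]) k t)).
rewrite -int_lin//; apply: int_le => //; first exact: bounded_measurable_lin.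
by move=> t /gk; rewrite ler_norml mul0r addr0 mulN1r => /andP[].
Qed.

(** Integrals up to x become integrals over the whole unit interval, where
    linearity and monotonicity in the integrand are available. *)
Lemma int_below nu k x : x <= 1 ->
  \int[nu]_(t in `[0, x]) k t = \int[nu]_(t in `[0, 1]) (below x t * k t).
Proof.
move=> x1.
rewrite (_ : `[0, x]%classic = `[0, 1]%classic `&` `]-oo, x]%classic).
  rewrite Rintegral_mkcondr; apply: eq_Rintegral => t _.
  by rewrite /patch /below mem_setE in_itv /=; case: (t <= x);
    rewrite ?mul1r ?mul0r.
apply/seteqP; split=> t /=; rewrite !in_itv /=.
  by move=> /andP[-> tx]; split=> //; exact: le_trans x1.
by move=> [/andP[-> _] ->].
Qed.

End bounded_measurable.

(** * The potential of a bounded function *)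

Section potential.
Context {R : realType}.
Implicit Types (g k : R -> R) (x y t a c e d M : R).
Implicit Type nu : probability (measurableTypeR R) R.

(** Continuity of nu along the intervals shrinking to the null set [set x]. *)
Lemma non_atomic_small nu x e : non_atomic nu -> 0 < e ->
  exists2 d, 0 < d & (nu `](x - d)%R, (x + d)%R[%classic <= e%:E)%E.
Proof.
move=> nua e0.
pose F n := `](x - n.+1%:R^-1), (x + n.+1%:R^-1)[%classic : set R.
have FE : \bigcap_n F n = [set x].
  apply/seteqP; split=> [y Fy /=|_ -> n _]; last first.
    by rewrite /F /= in_itv /= ltrBlDr ltrDl invr_gt0 ltr0Sn.
  apply/eqP/contraT => yx; have : 0 < `|y - x| by rewrite normr_gt0 subr_eq0.
  move=> /ltr_add_invr[n]; rewrite add0r => nyx.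
  have := Fy n I; rewrite /F /= in_itv /= => /andP[h1 h2].
  suff : `|y - x| < n.+1%:R^-1 by move=> /(lt_trans nyx); rewrite ltxx.
  by rewrite ltr_norml ltrBrDl h1 ltrBlDl.
have : nu (F n) @[n --> \oo] --> nu (\bigcap_n F n).
  apply: nonincreasing_cvg_mu.
  - by rewrite (le_lt_trans (probability_le1 _ _)) ?ltry//;
      exact: measurable_itv.
  - by move=> n; rewrite /F; exact: measurable_itv.
  - by rewrite FE; exact: measurable_set1.
  - move=> n m nm; apply/subsetPset => y.
    rewrite /F /= !in_itv /= => /andP[h1 h2].
    have : m.+1%:R^-1 <= n.+1%:R^-1 :> R by rewrite lef_pV2 ?posrE// ler_nat.
    move=> mn; apply/andP; split.
      by apply: le_lt_trans h1; rewrite lerD2l lerN2.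
    by apply: lt_le_trans h2 _; rewrite lerD2l.
rewrite FE nua => /fine_cvgP[_ /cvgrPdist_le/(_ e e0)][N _ /(_ N (leqnn N))] /=.
rewrite sub0r normrN => h; exists N.+1%:R^-1; first by rewrite invr_gt0.
rewrite -[leLHS]fineK ?lee_fin; first exact: le_trans (ler_norm _) h.
by rewrite ge0_fin_numE// (le_lt_trans (probability_le1 nu _))// ltry.
Qed.

(** The integral of (x - t)^+ k(t) with respect to nu. Its second derivative
    with respect to nu is k, and it vanishes at 0 with its derivative. *)
Definition potential nu k x :=
  \int[nu]_(t in `[0, 1]) (below x t * (x - t) * k t).

(** The primitive of k with respect to nu. *)
Definition cumul nu k x := \int[nu]_(t in `[0, x]) k t.

Lemma within_continuous_affine a c :
  {within `[0, 1], continuous (fun t => a + c * t)}.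
Proof. exact: is_C1_continuous (is_C1_affine a c). Qed.

Lemma bounded_measurable_kernel x :
  bounded_measurable (fun t => below x t * (x - t)).
Proof.
apply: bounded_measurableM; first exact: bounded_measurable_below.
rewrite (_ : (fun t => _) = (fun t => x + (-1) * t)).
  by apply: bounded_measurable_continuous; exact: within_continuous_affine.
by apply/funext => t; rewrite mulN1r.
Qed.

Let near x d : R -> R := \1_`]x - d, x + d[.

Let bounded_measurable_near x d : bounded_measurable (near x d).
Proof.
split; first exact: measurable_indic.
by exists 1 => t _; rewrite /near indicE; case: (_ \in _);
  rewrite ?normr0 ?normr1.
Qed.

Let int_near nu x d e : (nu `](x - d)%R, (x + d)%R[%classic <= e%:E)%E ->
  \int[nu]_(t in `[0, 1]) near x d t <= e.
Proof.
move=> h; rewrite /Rintegral integral_indic//.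
have h' : (nu (`](x - d)%R, (x + d)%R[ `&` `[0%R, 1%R]) <= e%:E)%E.
  apply: le_trans h; apply: le_measure; rewrite ?inE.
  - by apply: measurableI; exact: measurable_itv.
  - exact: measurable_itv.
  - exact: subIsetl.
rewrite -lee_fin fineK//.
by rewrite ge0_fin_numE// (le_lt_trans h')// ltry.
Qed.

Let nearE x d t : near x d t = (`|t - x| < d)%R%:R.
Proof.
rewrite /near indicE mem_setE in_itv /=; congr (_%:R); congr nat_of_bool.
by rewrite ltr_norml ltrBrDl [X in _ = _ && X]ltrBlDl.
Qed.

Lemma cumul_below nu k x : x <= 1 ->
  cumul nu k x = \int[nu]_(t in `[0, 1]) (below x t * k t).
Proof. exact: int_below. Qed.

Lemma cumul_lin nu g k a c x : bounded_measurable g -> bounded_measurable k ->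
  x <= 1 ->
  cumul nu (fun t => a * g t + c * k t) x = a * cumul nu g x + c * cumul nu k x.
Proof.
move=> bg bk x1; rewrite !cumul_below// -int_lin.
- by apply: eq_int => t _; ring.
- by apply: bounded_measurableM => //; exact: bounded_measurable_below.
- by apply: bounded_measurableM => //; exact: bounded_measurable_below.
Qed.

Lemma eq_cumul nu g k x : x <= 1 -> (forall t, 0 <= t <= 1 -> g t = k t) ->
  cumul nu g x = cumul nu k x.
Proof. by move=> x1 gk; rewrite !cumul_below//; apply: eq_int => t /gk ->. Qed.

Lemma cumul0 nu k : non_atomic nu -> cumul nu k 0 = 0.
Proof.
move=> nua; rewrite /cumul set_itv1.
rewrite (@eq_Rintegral _ _ _ _ _ (cst (k 0))).
  rewrite Rintegral_cst// -[RHS](mulr0 (k 0)); congr (_ * _).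
  by rewrite -[RHS]/(fine 0%E); congr fine; exact: nua.
by move=> t; rewrite inE => ->.
Qed.

(* Integrands supported near x have small integrals. *)
Let int_local nu k h M x d c : on_unit_interval nu -> bounded_measurable k ->
  (forall t, 0 <= t <= 1 -> `|k t| <= M) -> 0 <= c -> bounded_measurable h ->
  (forall t, `|h t| <= c * near x d t) ->
  `|\int[nu]_(t in `[0, 1]) (h t * k t)| <=
     c * (M * \int[nu]_(t in `[0, 1]) near x d t).
Proof.
move=> n1 bk kM c0 bh hn.
rewrite mulrA -[leRHS]addr0 -[X in _ + X](mul0r (\int[nu]_(t in `[0, 1]) k t)).
rewrite -int_lin//; apply: int_norm_le => //.
- exact: bounded_measurableM.
- exact: bounded_measurable_lin.
- move=> t t01; rewrite mul0r addr0 normrM mulrAC ler_pM//; exact: kM.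
Qed.

Lemma cumul_modulus nu k M x y d e : on_unit_interval nu ->
  bounded_measurable k -> (forall t, 0 <= t <= 1 -> `|k t| <= M) -> 0 <= M ->
  x <= 1 -> y <= 1 -> `|y - x| < d ->
  (nu `](x - d)%R, (x + d)%R[%classic <= e%:E)%E ->
  `|cumul nu k y - cumul nu k x| <= M * e.
Proof.
move=> n1 bk kM M0 x1 y1 yx nd; have bb := @bounded_measurable_below R.
apply: le_trans (ler_wpM2l M0 (int_near nd)).
rewrite -[leRHS]mul1r !cumul_below// -[X in X - _]mul1r -mulN1r -int_lin;
  try exact: bounded_measurableM.
under eq_Rintegral do rewrite !mulrA -mulrDl mul1r mulN1r.
apply: int_local => //.
  rewrite (_ : (fun t => _) = (fun t => 1 * below y t + (-1) * below x t)).
    exact: bounded_measurable_lin.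
  by apply/funext => t; rewrite mul1r mulN1r.
move=> t; rewrite mul1r nearE /below.
case: (leP t y) => ty; case: (leP t x) => tx; rewrite ?subrr ?normr0 ?ler0n//.
  rewrite subr0 normr1 (_ : `|t - x| < d) ?lexx//.
  by move: yx; rewrite !ltr_norml => /andP[? ?]; apply/andP; split; lra.
rewrite sub0r normrN normr1 (_ : `|t - x| < d) ?lexx//.
by move: yx; rewrite !ltr_norml => /andP[? ?]; apply/andP; split; lra.
Qed.

(** The increment of the potential between x and y differs from y - x times
    the primitive at x only through the points t between x and y, whose mass is
    small. *)
Lemma potential_C1 nu k : on_unit_interval nu -> non_atomic nu ->
  bounded_measurable k -> is_C1 (potential nu k) (cumul nu k).
Proof.
move=> n1 nua bk; have [_ [M kM]] := bk.
have M0 : 0 <= M by apply: le_trans (kM 0 _); rewrite ?normr_ge0 ?lexx ?ler01.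
have M1 : 0 < M + 1 by rewrite ltr_pwDr.
have small x e : 0 < e -> exists d e',
    [/\ 0 < d, (nu `](x - d)%R, (x + d)%R[%classic <= e'%:E)%E & M * e' <= e].
  move=> e0; have [d d0 hd] := non_atomic_small x nua (divr_gt0 e0 M1).
  exists d, (e / (M + 1)); split=> //.
  by rewrite mulrCA ger_pMr// ler_pdivrMr// mul1r lerDl.
have bb := bounded_measurable_below; have bker := bounded_measurable_kernel.
apply/is_C1P; split.
  apply/within_continuousP => x /andP[_ x1] e e0.
  have [d [e' [d0 hd he]]] := small x _ (divr_gt0 e0 (ltr0n R 2)).
  exists d => // y /andP[_ y1] yx.
  have e2 : e / 2 < e by rewrite ltr_pdivrMr// ltr_pMr// ltr1n.
  apply: le_lt_trans e2; apply: le_trans he; exact: cumul_modulus hd.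
move=> x x01 e e0; have [d [e' [d0 hd he]]] := small x e e0.
exists d => // y y01 yx.
have [/andP[_ x1] /andP[_ y1]] := (x01, y01).
have {}he : M * \int[nu]_(t in `[0, 1]) near x d t <= e.
  exact: le_trans (ler_wpM2l M0 (int_near hd)) he.
set r := `|y - x|; pose h t :=
  below y t * (y - t) - below x t * (x - t) - (y - x) * below x t.
rewrite (_ : _ - _ = \int[nu]_(t in `[0, 1]) (h t * k t)).
  rewrite mulrC; apply: le_trans (ler_wpM2l (normr_ge0 _) he);
    apply: int_local => //.
    rewrite (_ : h = (fun t => 1 * (1 * (below y t * (y - t)) +
        (-1) * (below x t * (x - t))) + (x - y) * below x t)).
      by do 2! apply: bounded_measurable_lin => //.
    by apply/funext => t; rewrite /h; ring.
  move=> t; rewrite nearE /h /below.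
  have yx' := yx; move: yx'; rewrite /r ltr_norml => /andP[yx1 yx2].
  have ryx : y - x <= r by exact: ler_norm.
  have rxy : x - y <= r by rewrite /r distrC; exact: ler_norm.
  have := normr_ge0 (y - x); rewrite -/r => r0.
  have near1 : -d < t - x -> t - x < d -> (`|t - x| < d)%R.
    by move=> ? ?; rewrite ltr_norml; apply/andP.
  case: (leP t y) => ty; case: (leP t x) => tx.
  - by rewrite !mul1r mulr1 (_ : _ - _ = 0) ?normr0 ?mulr_ge0//; ring.
  - rewrite near1; [|lra|lra]; rewrite mul1r mul0r mulr0 !subr0 mulr1.
    by rewrite ger0_norm ?subr_ge0//; lra.
  - rewrite near1; [|lra|lra]; rewrite mul1r mul0r !mulr1 sub0r.
    by rewrite ler_norml; apply/andP; split; lra.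
  - by rewrite !mul0r mulr0 !subrr normr0 mulr_ge0.
rewrite /potential !cumul_below//.
rewrite -[X in X - _ - _]mul1r -[X in _ - X - _]mul1r -mulNr -int_lin;
  last first.
- exact: bounded_measurableM.
- exact: bounded_measurableM.
rewrite -[X in X - _]mul1r [X in _ - X]mulrC -mulNr.
rewrite -int_lin; last first.
- exact: bounded_measurableM.
- by apply: bounded_measurable_lin; exact: bounded_measurableM.
by apply: eq_int => t _; rewrite /h; ring.
Qed.

End potential.

(** * Existence of solutions *)

Section existence.
Context {R : realType}.
Implicit Types (g h k u du : R -> R) (x y t a c e d M lambda : R).
Implicit Type nu : probability (measurableTypeR R) R.

Lemma int_cvg nu (g_ : nat -> R -> R) g M :
  (forall n, bounded_measurable (g_ n)) -> bounded_measurable g ->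
  (forall t, 0 <= t <= 1 -> g_ n t @[n --> \oo] --> g t) ->
  (forall n t, 0 <= t <= 1 -> `|g_ n t| <= M) ->
  \int[nu]_(t in `[0, 1]) g_ n t @[n --> \oo] --> \int[nu]_(t in `[0, 1]) g t.
Proof.
move=> bg_ bg cg gM.
have mg n : measurable_fun (`[0, 1]%classic : set (measurableTypeR R))
    (EFin \o g_ n).
  by apply/measurable_EFinP; case: (bg_ n).
have [|||||ig _ cv] := @dominated_convergence _ _ _ nu `[0, 1]%classic _
  (fun n => EFin \o g_ n) (EFin \o g) (EFin \o cst M) mg.
- exact: measurable_itv.
- by apply/measurable_EFinP; case: bg.
- apply: aeW => t; rewrite /= in_itv /= => t01.
  by apply: cvg_EFin; [exact: nearW|exact: cg].
- by apply: bounded_measurable_integrable; exact: bounded_measurable_cst.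
- by apply: aeW => t n; rewrite /= in_itv /= => t01; rewrite lee_fin; exact: gM.
apply: fine_cvg; rewrite /Rintegral fineK; first exact: cv.
by apply: integrable_fin_num.
Qed.

Lemma potential_le nu g k x : bounded_measurable g -> bounded_measurable k ->
  (forall t, 0 <= t <= 1 -> g t <= k t) -> potential nu g x <= potential nu k x.
Proof.
move=> bg bk gk; have bker := bounded_measurable_kernel x.
apply: int_le => [||t t01]; [exact: bounded_measurableM..|].
rewrite ler_wpM2l ?gk//; rewrite /below.
by case: (leP t x) => tx; rewrite ?mul1r ?mul0r ?subr_ge0.
Qed.

Lemma potential0 nu k : non_atomic nu -> potential nu k 0 = 0.
Proof.
move=> nua; rewrite /potential.
under eq_Rintegral.
  move=> t; rewrite inE /= in_itv /= => /andP[t0 _].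
  rewrite (_ : below 0 t * (0 - t) * k t = 0); last first.
    rewrite /below; case: (leP t 0) => [t0'|_]; last by rewrite !mul0r.
    by rewrite (_ : t = 0) ?subrr ?mulr0 ?mul0r//; apply/eqP; rewrite eq_le t0'.
  over.
by rewrite Rintegral_cst// mul0r.
Qed.

(** Monotone Picard iteration: the iterates increase from 0 and stay below a
    multiple of an exponential. The limit is only known to be measurable, but
    one more application of the integral operator makes it C1. *)
Lemma volterra nu lambda a c h : on_unit_interval nu -> non_atomic nu ->
  0 < lambda -> 0 <= a -> 0 <= c -> bounded_measurable h ->
  (forall t, 0 <= t <= 1 -> 0 <= h t) ->
  exists u du, [/\ is_C1 u du, u 0 = a,
    forall x, 0 <= x <= 1 -> a + c * x <= u x &
    forall x, 0 <= x <= 1 ->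
      du x = c + cumul nu (fun t => lambda * u t + 1 * h t) x].
Proof.
move=> n1 nua l0 a0 c0 bh h0; have [_ [m hm]] := bh.
have l0' := ltW l0.
have m0 : 0 <= m by apply: le_trans (hm 0 _); rewrite ?normr_ge0 ?lexx ?ler01.
pose step u x := (a + c * x) + potential nu (fun t => lambda * u t + 1 * h t) x.
pose S n := iter n step (cst 0).
have SE n : S n.+1 = step (S n) by [].
have bl u : bounded_measurable u ->
    bounded_measurable (fun t => lambda * u t + 1 * h t).
  by move=> bu; exact: bounded_measurable_lin.
have Cstep u : bounded_measurable u -> is_C1 (step u)
    (fun x => c + cumul nu (fun t => lambda * u t + 1 * h t) x).
  move=> bu; rewrite /step.
  have := is_C1_lin 1 1 (is_C1_affine a c) (potential_C1 n1 nua (bl u bu)).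
  congr is_C1; apply/funext => x; by rewrite !mul1r.
have bS n : bounded_measurable (S n).
  elim: n => [|n IH]; first exact: bounded_measurable_cst.
  rewrite SE; apply: bounded_measurable_continuous.
  exact: is_C1_continuous (Cstep _ IH).
have stepm u v : bounded_measurable u -> bounded_measurable v ->
    (forall t, 0 <= t <= 1 -> u t <= v t) -> forall x, step u x <= step v x.
  move=> bu bv uv x; rewrite /step lerD2l; apply: potential_le; [exact: bl..|].
  by move=> t t01; rewrite lerD2r ler_wpM2l// uv.
have step0 u x : bounded_measurable u -> 0 <= x <= 1 ->
   (forall t, 0 <= t <= 1 -> 0 <= u t) -> a + c * x <= step u x.
  move=> bu x01 u0; rewrite /step lerDl.
  rewrite (_ : 0 = potential nu (cst 0) x).
    apply: potential_le; [exact: bounded_measurable_cst|exact: bl|].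
    by move=> t t01; rewrite /= mul1r addr_ge0 ?mulr_ge0 ?u0 ?h0.
  rewrite /potential; under eq_Rintegral do rewrite mulr0.
  by rewrite Rintegral_cst// mul0r.
have ac0 x : 0 <= x <= 1 -> 0 <= a + c * x.
  by move=> /andP[x0 _]; rewrite addr_ge0// mulr_ge0.
have S0 n x : 0 <= x <= 1 -> 0 <= S n x.
  elim: n x => [|n IH] x x01; first exact: lexx.
  by rewrite SE (le_trans (ac0 x x01))// step0.
have Sm n x : 0 <= x <= 1 -> S n x <= S n.+1 x.
  elim: n x => [|n IH] x x01; first exact: S0.
  by rewrite SE (SE n.+1); exact: stepm.
(* With s = x - t, the bound K * s <= expR (K * s) gives a factor
   lambda / K = 1 / 2 in front of the exponential; the other half of C is for
   the data. *)
pose K := 2 * lambda; pose C := 2 * (a + c + m).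
have K0 : 0 < K by rewrite mulr_gt0.
have C0 : 0 <= C by rewrite mulr_ge0// !addr_ge0.
have cB : {within `[0, 1], continuous (fun x => C * expR (K * x))}.
  apply: continuous_subspaceT => x; apply: cvgM; first exact: cvg_cst.
  apply: continuous_comp; last exact: continuous_expR.
  by apply: cvgM; [exact: cvg_cst|exact: cvg_id].
have SB n x : 0 <= x <= 1 -> S n x <= C * expR (K * x).
  elim: n x => [|n IH] x x01; first by rewrite /= mulr_ge0// expR_ge0.
  rewrite SE; apply: le_trans (stepm _ _ (bS n) _ IH x) _.
    exact: bounded_measurable_continuous.
  rewrite /step.
  have : potential nu (fun t => lambda * (C * expR (K * t)) + 1 * h t) x <=
      lambda * C * (expR (K * x) / K) + m.
    rewrite -[leRHS](int_cst _ n1); apply: int_le.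
    - apply: bounded_measurableM; first exact: bounded_measurable_kernel.
      by apply: bl; exact: bounded_measurable_continuous.
    - exact: bounded_measurable_cst.
    move=> t t01; rewrite /below /=.
    have e0 : 0 <= expR (K * x) / K by rewrite divr_ge0 ?expR_ge0// ltW.
    case: (leP t x) => tx; last first.
      by rewrite !mul0r addr_ge0//; apply: mulr_ge0 => //; exact: mulr_ge0.
    rewrite !mul1r mulrDr lerD//.
      rewrite mulrCA (mulrCA (x - t)) -mulrA; do 2! apply: ler_wpM2l => //.
      rewrite ler_pdivlMr// mulrAC (_ : K * x = K * (x - t) + K * t);
        last by ring.
      rewrite expRD ler_wpM2r ?expR_ge0//.
      by rewrite mulrC (le_trans _ (expR_ge1Dx _))// lerDr.
    have /andP[t0 t1] := t01; have /andP[x0 x1] := x01.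
    rewrite -[leRHS]mul1r ler_pM ?h0 ?subr_ge0//; first lra.
    exact: le_trans (ler_norm _) (hm t t01).
  rewrite (_ : lambda * C * (expR (K * x) / K) = C / 2 * expR (K * x));
    last first.
    by rewrite /K; field; rewrite gt_eqF.
  have /andP[x0 x1] := x01.
  have : 1 <= expR (K * x) by rewrite (le_trans _ (expR_ge1Dx _))//
    lerDl mulr_ge0// ltW.
  have := ler_wpM2l c0 x1; rewrite mulr1.
  have -> : C = 2 * (a + c + m) by []; nra.
pose u x := limn (fun n => S n x).
have Su x : 0 <= x <= 1 -> S n x @[n --> \oo] --> u x.
  move=> x01; apply: nondecreasing_is_cvgn.
    by apply/nondecreasing_seqP => n; exact: Sm.
  by exists (C * expR (K * x)) => _ [n _ <-]; exact: SB.
have SM n x : 0 <= x <= 1 -> `|S n x| <= C * expR K.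
  move=> x01; rewrite ger0_norm ?S0// (le_trans (SB n x x01))// ler_wpM2l//.
  by rewrite ler_expR ger_pMr//; case/andP: x01.
have u0 x : 0 <= x <= 1 -> 0 <= u x.
  move=> x01; apply: limr_ge; first exact: Su.
  by apply: nearW => n; exact: S0.
have uM x : 0 <= x <= 1 -> `|u x| <= C * expR K.
  move=> x01; rewrite ger0_norm ?u0//; apply: limr_le; first exact: Su.
  by apply: nearW => n; exact: le_trans (ler_norm _) (SM n x x01).
have bu : bounded_measurable u.
  split; last by exists (C * expR K).
  apply: (@measurable_fun_cvg _ _ _ _ S).
    by move=> n; case: (bS n).
  by move=> x; rewrite /= in_itv /=; exact: Su.
have uE x : 0 <= x <= 1 -> u x = step u x.
  move=> x01; apply: (cvg_unique _ (Su x x01)) => //.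
  suff : S n.+1 x @[n --> \oo] --> step u x.
    by rewrite (@cvg_shiftS _ (fun n => S n x)).
  apply: cvgD; first exact: cvg_cst.
  apply: (@int_cvg _ _ _ (lambda * (C * expR K) + m)).
  - move=> n; apply: bounded_measurableM; last exact: bl.
    exact: bounded_measurable_kernel.
  - by apply: bounded_measurableM; [exact: bounded_measurable_kernel|exact: bl].
  - move=> t t01; apply: cvgM; first exact: cvg_cst.
    apply: cvgD; last exact: cvg_cst.
    by apply: cvgM; [exact: cvg_cst|exact: Su].
  - move=> n t t01; rewrite normrM -[leRHS]mul1r ler_pM//.
      have /andP[t0 t1] := t01; have /andP[x0 x1] := x01.
      rewrite /below; case: (leP t x) => tx; rewrite ?mul0r ?normr0// mul1r.
      by rewrite ger0_norm ?subr_ge0//; lra.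
    rewrite (le_trans (ler_normD _ _))// mul1r lerD ?hm//.
    by rewrite normrM ger0_norm// ler_wpM2l// SM.
exists (step u), (fun x => c + cumul nu (fun t => lambda * u t + 1 * h t) x).
split.
- exact: Cstep.
- by rewrite /step mulr0 addr0 potential0// addr0.
- by move=> x x01; exact: step0.
- move=> x /andP[_ x1]; congr (_ + _); apply: eq_cumul => // t t01.
  by rewrite -uE.
Qed.

End existence.

(** * The boundary value problem *)

Section boundary_value_problem.
Context {R : realType}.
Implicit Types (g h k u du w dw : R -> R) (x y t a c e d M lambda : R).
Implicit Type nu : probability (measurableTypeR R) R.

(** u has derivative du and solves lambda u - u'' = g on the unit interval,
    the second derivative being taken with respect to nu. *)
Definition solves nu lambda g u du :=
  is_C1 u du /\ forall x, 0 <= x <= 1 ->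
    du x = du 0 + cumul nu (fun t => lambda * u t - g t) x.

Lemma solves_bounded_measurable nu lambda g u du : bounded_measurable g ->
  solves nu lambda g u du -> bounded_measurable (fun t => lambda * u t - g t).
Proof.
move=> bg [Cu _].
rewrite (_ : (fun t => _) = fun t => lambda * u t + (-1) * g t).
  apply: bounded_measurable_lin => //.
  by apply: bounded_measurable_continuous; exact: is_C1_continuous Cu.
by apply/funext => t; rewrite mulN1r.
Qed.

Lemma solves_lin nu lambda g h u du w dw a c :
  bounded_measurable g -> bounded_measurable h ->
  solves nu lambda g u du -> solves nu lambda h w dw ->
  solves nu lambda (fun t => a * g t + c * h t)
    (fun t => a * u t + c * w t) (fun t => a * du t + c * dw t).
Proof.
move=> bg bh su sw; have [Cu Eu] := su; have [Cw Ew] := sw.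
split; first exact: is_C1_lin.
move=> x x01; rewrite (Eu x)// (Ew x)//; have /andP[_ x1] := x01.
transitivity (a * du 0 + c * dw 0 +
    cumul nu (fun t => a * (lambda * u t - g t) + c * (lambda * w t - h t)) x).
  rewrite cumul_lin//; first by ring.
    exact: solves_bounded_measurable su.
  exact: solves_bounded_measurable sw.
by congr (_ + _); apply: eq_cumul => // t _; ring.
Qed.

Lemma eq_solves nu lambda g h u du : (forall t, 0 <= t <= 1 -> g t = h t) ->
  solves nu lambda g u du -> solves nu lambda h u du.
Proof.
move=> gh [Cu Eu]; split=> // x x01; rewrite Eu//; congr (_ + _).
by apply: eq_cumul => [|t /gh ->//]; case/andP: x01.
Qed.

Lemma cumul1 nu k : cumul nu k 1 = \int[nu]_(t in `[0, 1]) k t.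
Proof. by []. Qed.

(** For a nonpositive right-hand side the solution with nonnegative data at 0
    stays above its tangent at 0; the bound on du 1 makes Neumann shooting
    possible. *)
Lemma volterra_solves nu lambda a c h : on_unit_interval nu -> non_atomic nu ->
  0 < lambda -> 0 <= a -> 0 <= c -> bounded_measurable h ->
  (forall t, 0 <= t <= 1 -> h t <= 0) ->
  exists u du, [/\ solves nu lambda h u du, u 0 = a, du 0 = c,
    forall x, 0 <= x <= 1 -> a + c * x <= u x &
    lambda * a <= du 1].
Proof.
move=> n1 nua l0 a0 c0 bh h0.
have bNh : bounded_measurable (fun t => - h t).
  have := bounded_measurable_lin (-1) 0 bh bh; congr bounded_measurable.
  by apply/funext => t; rewrite mulN1r mul0r addr0.
have [|u [du [Cu ua uac Eu]]] := volterra n1 nua l0 a0 c0 bNh.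
  by move=> t t01; rewrite oppr_ge0 h0.
have z01 : 0 <= (0 : R) <= 1 by rewrite lexx ler01.
have i01 : 0 <= (1 : R) <= 1 by rewrite lexx ler01.
have du0 : du 0 = c by rewrite Eu// cumul0// addr0.
exists u, du; split=> //.
  split=> // x x01; rewrite Eu// du0; congr (_ + _); apply: eq_cumul.
    by case/andP: x01.
  by move=> t _; rewrite mul1r.
rewrite Eu// cumul1 -[lambda * a](int_cst _ n1) -[leLHS]add0r lerD//.
apply: int_le; first exact: bounded_measurable_cst.
  apply: bounded_measurable_lin => //.
  by apply: bounded_measurable_continuous; exact: is_C1_continuous Cu.
move=> t t01; rewrite mul1r -[leLHS]addr0 lerD ?oppr_ge0 ?h0//.
rewrite ler_wpM2l ?(ltW l0)// (le_trans _ (uac t t01))// lerDl.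
by rewrite mulr_ge0//; case/andP: t01.
Qed.

(** Shooting: a particular solution with zero data at 0, plus the multiple of a
    homogeneous solution that corrects the boundary value at 1. *)
Lemma solution_exists b nu lambda g : on_unit_interval nu -> non_atomic nu ->
  0 < lambda -> bounded_measurable g ->
  exists u du, solves nu lambda g u du /\ boundary_condition b u du.
Proof.
move=> n1 nua l0 bg; have [_ [M gM]] := bg.
have bc := @bounded_measurable_cst R.
have M0 : 0 <= M by apply: le_trans (gM 0 _); rewrite ?normr_ge0 ?lexx ?ler01.
have r0 : 0 <= 0 :> R by exact: lexx.
have r1 := @ler01 R.
(* With g bounded by M, solve for the nonpositive g - M and - M and subtract. *)
have [p [dp [sp p0 dp0]]] : exists p dp,
    [/\ solves nu lambda g p dp, p 0 = 0 & dp 0 = 0].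
  have [||u [du [su u0 du0 _ _]]] := @volterra_solves nu lambda 0 0
     (fun t => 1 * g t + (-1) * M) n1 nua l0 r0 r0.
  - exact: (bounded_measurable_lin 1 (-1) bg (bc M)).
  - move=> t t01; rewrite mul1r mulN1r subr_le0.
    exact: le_trans (ler_norm _) (gM t t01).
  have [|w [dw [sw w0 dw0 _ _]]] := @volterra_solves nu lambda 0 0
     (cst (- M)) n1 nua l0 r0 r0 (bc _).
    by move=> t _; rewrite /= oppr_le0.
  exists (fun t => 1 * u t + (-1) * w t), (fun t => 1 * du t + (-1) * dw t).
  rewrite u0 w0 du0 dw0 mulr0 mulr0 addr0; split=> //.
  apply: eq_solves (solves_lin 1 (-1) _ (bc _) su sw).
    by move=> t _ /=; ring.
  exact: (bounded_measurable_lin 1 (-1) bg (bc M)).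
have adj q dq c : solves nu lambda (cst 0) q dq ->
    solves nu lambda g (fun t => 1 * p t + c * q t)
      (fun t => 1 * dp t + c * dq t).
  move=> sq; apply: eq_solves (solves_lin 1 c bg (bc _) sp sq).
  by move=> t _; rewrite /= mulr0 addr0 mul1r.
have sol0 a c : 0 <= a -> 0 <= c -> exists u du,
   [/\ solves nu lambda (cst 0) u du, u 0 = a, du 0 = c,
    forall x, 0 <= x <= 1 -> a + c * x <= u x & lambda * a <= du 1].
  move=> a0 c0; apply: (@volterra_solves nu lambda a c (cst 0)) => //.
case: b.
  have [q [dq [sq q0 dq0 _ dq1]]] := sol0 1 0 r1 r0.
  rewrite mulr1 in dq1.
  exists (fun t => 1 * p t + (- (dp 1 / dq 1)) * q t),
    (fun t => 1 * dp t + (- (dp 1 / dq 1)) * dq t); split; first exact: adj.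
  rewrite /= dp0 dq0 !mulr0 addr0; split=> //.
  by rewrite mul1r mulNr divfK ?subrr// gt_eqF// (lt_le_trans l0).
have [q [dq [sq q0 dq0 q1 _]]] := sol0 0 1 r0 r1.
exists (fun t => 1 * p t + (- (p 1 / q 1)) * q t),
  (fun t => 1 * dp t + (- (p 1 / q 1)) * dq t); split; first exact: adj.
rewrite /= p0 q0 !mulr0 addr0; split=> //.
rewrite mul1r mulNr divfK ?subrr// gt_eqF//.
by apply: lt_le_trans (q1 1 _); rewrite ?add0r ?mulr1 ?ltr01 ?r1 ?lexx.
Qed.

End boundary_value_problem.

(** * The maximum principle *)

Section maximum_principle.
Context {R : realType}.
Implicit Types (g h k u du w dw W dW E : R -> R).
Implicit Types (x y z t a c e d M lambda eta : R).
Implicit Type nu : probability (measurableTypeR R) R.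

Lemma is_C1_reflect f df : is_C1 f df ->
  is_C1 (fun x => f (1 - x)) (fun x => - df (1 - x)).
Proof.
move=> /is_C1P[/within_continuousP cdf h].
have r01 x : 0 <= x <= 1 -> 0 <= 1 - x <= 1.
  by move=> /andP[? ?]; apply/andP; split; lra.
have rE x y : (1 - y) - (1 - x) = - (y - x) by ring.
apply/is_C1P; split.
  apply/within_continuousP => x /r01 x01 e /(cdf _ x01)[d d0 {}h].
  exists d => // y /r01 y01 yx; rewrite -opprD normrN h//.
  by rewrite rE normrN.
move=> x /r01 x01 e e0; have [d d0 {}h] := h _ x01 e e0.
exists d => // y /r01 y01 yx; have := h _ y01.
rewrite rE normrN => /(_ yx).
by rewrite mulrN mulNr.
Qed.

(** dW is nondecreasing on every interval on which W is at least eta. *)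
Definition convex_above eta W dW := forall x y, 0 <= x -> x <= y -> y <= 1 ->
  (forall z, x <= z <= y -> eta <= W z) -> dW x <= dW y.

(** Starting above eta with a nonnegative slope, W cannot come back down:
    otherwise consider the largest interval to the right of x on which W is at
    least eta; W is nondecreasing there. *)
Lemma convex_above_right eta W dW x : is_C1 W dW -> convex_above eta W dW ->
  0 <= x <= 1 -> eta < W x -> 0 <= dW x ->
  forall y, x <= y <= 1 -> W x <= W y.
Proof.
move=> CW cvx /andP[x0 x1] Wx dWx.
have inc y : x <= y <= 1 -> (forall z, x <= z < y -> eta <= W z) -> W x <= W y.
  move=> /andP[xy y1] h; apply: (is_C1_incr CW) => // z /andP[xz zy].
  apply: le_trans dWx _; apply: cvx => //;
    [exact: ltW|exact: le_trans (ltW zy) y1|].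
  by move=> v /andP[xv vz]; apply: h; rewrite xv (le_lt_trans vz).
suff above y : x <= y <= 1 -> eta <= W y.
  move=> y xy1; apply: inc => // z /andP[xz zy]; apply: above.
  by rewrite xz (le_trans (ltW zy))//; case/andP: xy1.
move=> /andP[xy y1]; rewrite leNgt; apply/negP => Wy.
pose B := [set z | x <= z <= y /\ forall v, x <= v <= z -> eta <= W v].
have Bx : B x.
  split; first by rewrite lexx.
  by move=> v; rewrite -eq_le => /eqP <-; exact: ltW.
have hB : has_sup B by split; [exists x|exists y => z [/andP[]]].
have xs : x <= sup B by apply: ub_le_sup Bx; exact: hB.2.
have sy : sup B <= y by apply: ge_sup => [|z [/andP[]]//]; exists x.
have belowB v : x <= v -> v < sup B -> eta <= W v.
  move=> xv vs; have [z [_ hz] vz] := sup_gt hB.1 vs.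
  by apply: hz; rewrite xv ltW.
have s1 : sup B <= 1 by exact: le_trans y1.
have Ws : W x <= W (sup B).
  by apply: inc => [|v /andP[]]; [rewrite xs|exact: belowB].
have sy' : sup B < y.
  rewrite lt_neqAle sy andbT; apply/eqP => sE.
  by move: Wy; rewrite -sE ltNge (le_trans (ltW Wx)).
have /within_continuousP cW := is_C1_continuous CW.
have s01 : 0 <= sup B <= 1 by rewrite (le_trans x0).
have We : 0 < W (sup B) - eta by rewrite subr_gt0 (lt_le_trans Wx).
have [d d0 hd] := cW _ s01 _ We.
pose r := Num.min (d / 2) (y - sup B).
have r0 : 0 < r by rewrite lt_min divr_gt0//= subr_gt0.
have : B (sup B + r).
  have rd : r <= d / 2 by rewrite ge_min lexx.
  have ry : r <= y - sup B by rewrite ge_min lexx orbT.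
  split; first by apply/andP; split; lra.
  move=> v /andP[xv vr]; have [vs|sv] := ltP v (sup B); first exact: belowB.
  have := hd v; rewrite !ltr_norml => /(_ _ _)/andP[||h _]; last lra.
    by apply/andP; split; lra.
  by apply/andP; split; lra.
by move=> /(ub_le_sup hB.2); rewrite leNgt ltrDl r0.
Qed.

Lemma convex_above_left eta W dW x : is_C1 W dW -> convex_above eta W dW ->
  0 <= x <= 1 -> eta < W x -> dW x <= 0 ->
  forall y, 0 <= y <= x -> W x <= W y.
Proof.
move=> CW cvx /andP[x0 x1] Wx dWx y /andP[y0 yx].
have rK z : 1 - (1 - z) = z by ring.
have := @convex_above_right eta _ _ (1 - x) (is_C1_reflect CW).
rewrite /= rK => /(_ _ _ Wx _ (1 - y)); rewrite rK; apply.
- move=> u v u0 uv v1 h; rewrite lerN2; apply: cvx; [lra|lra|lra|].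
  by move=> z /andP[? ?]; rewrite -(rK z); apply: h; apply/andP; split; lra.
- by apply/andP; split; lra.
- by rewrite oppr_ge0.
- by apply/andP; split; lra.
Qed.

Lemma cumul_le nu k x y : bounded_measurable k -> x <= y -> y <= 1 ->
  (forall t, 0 <= t <= 1 -> x < t <= y -> 0 <= k t) ->
  cumul nu k x <= cumul nu k y.
Proof.
move=> bk xy y1 k0; rewrite !cumul_below ?(le_trans xy)//.
apply: int_le; try by apply: bounded_measurableM => //;
  exact: bounded_measurable_below.
move=> t t01; rewrite /below; case: (leP t x) => tx.
  by rewrite (le_trans tx xy).
by case: (leP t y) => ty; rewrite mul0r ?mul1r// k0// tx.
Qed.

(** At a point x with W x > eta, the sign of dW x propagates the bound
    W >= W x to one end of the interval, against the Dirichlet condition. The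
    Neumann condition forces dW x = 0, so that the bound propagates to both
    ends, while dW 1 - dW 0 = 0 is the integral of a positive function. *)
Lemma max_principle_upper b nu lambda W dW E eta : on_unit_interval nu ->
  0 < lambda -> is_C1 W dW -> bounded_measurable E ->
  (forall t, 0 <= t <= 1 -> - eta <= E t) ->
  (forall x, 0 <= x <= 1 ->
    dW x = dW 0 + cumul nu (fun t => lambda * (W t + E t)) x) ->
  match b with Neumann => dW 0 = 0 /\ dW 1 = 0
             | Dirichlet => W 0 <= eta /\ W 1 <= eta end ->
  forall x, 0 <= x <= 1 -> W x <= eta.
Proof.
move=> n1 l0 CW bE Ee WE bcW x x01; rewrite leNgt; apply/negP => Wx.
have bW := bounded_measurable_continuous (is_C1_continuous CW).
have bk : bounded_measurable (fun t => lambda * (W t + E t)).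
  apply: bounded_measurableM; first exact: bounded_measurable_cst.
  exact: bounded_measurableD.
have z01 : 0 <= (0 : R) <= 1 by rewrite lexx ler01.
have i01 : 0 <= (1 : R) <= 1 by rewrite lexx ler01.
have cvx : convex_above eta W dW.
  move=> y z y0 yz z1 h; rewrite (WE y) ?(WE z) ?y0 ?z1 ?(le_trans y0)
    ?(le_trans yz)//.
  rewrite lerD2l; apply: cumul_le => // t t01 /andP[yt tz].
  rewrite mulr_ge0 ?(ltW l0)//; have := Ee t t01; have := h t.
  by rewrite (ltW yt) tz => /(_ isT); lra.
have [x0 x1] := andP x01.
have right := convex_above_right CW cvx x01 Wx.
have left := convex_above_left CW cvx x01 Wx.
case: b bcW => -[b0 b1].
  have dx0 : 0 <= dW x.
    rewrite leNgt; apply/negP => dWx; have := left (ltW dWx) => {}left.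
    suff : dW 0 <= dW x by rewrite b0 leNgt dWx.
    by apply: cvx => // z zx; rewrite ltW// (lt_le_trans Wx)// left.
  have := right dx0 => {}right.
  have dx1 : dW x <= 0.
    rewrite -b1; apply: cvx => // z /right; apply: le_trans; exact: ltW.
  have := left dx1 => {}left.
  have all z : 0 <= z <= 1 -> W x <= W z.
    move=> /andP[z0 z1]; have [zx|/ltW xz] := leP z x;
      first by rewrite left ?z0.
    by rewrite right ?xz.
  have : lambda * (W x - eta) <= dW 1.
    rewrite WE// b0 add0r cumul1 -[leLHS](int_cst _ n1).
    apply: int_le => //; first exact: bounded_measurable_cst.
    move=> t t01; rewrite ler_wpM2l ?(ltW l0)//.
    by have := all t t01; have := Ee t t01; lra.
  by rewrite b1 leNgt mulr_gt0// subr_gt0.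
have [d0|/ltW d0] := leP 0 (dW x).
  by move: Wx; rewrite ltNge (le_trans (right d0 1 _))// x1 lexx.
by move: Wx; rewrite ltNge (le_trans (left d0 0 _))// x0 lexx.
Qed.

Lemma max_principle b nu lambda W dW E eta : on_unit_interval nu ->
  0 < lambda -> is_C1 W dW -> bounded_measurable E ->
  (forall t, 0 <= t <= 1 -> `|E t| <= eta) ->
  (forall x, 0 <= x <= 1 ->
    dW x = dW 0 + cumul nu (fun t => lambda * (W t + E t)) x) ->
  match b with Neumann => dW 0 = 0 /\ dW 1 = 0
             | Dirichlet => `|W 0| <= eta /\ `|W 1| <= eta end ->
  forall x, 0 <= x <= 1 -> `|W x| <= eta.
Proof.
move=> n1 l0 CW bE Ee WE bcW x x01; rewrite ler_norml; apply/andP; split;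
  last first.
  apply: (max_principle_upper (b := b) n1 l0 CW bE _ WE) => //.
    by move=> t /Ee; rewrite ler_norml => /andP[].
  by case: b bcW => -[]; rewrite ?ler_norml => // /andP[_ ->] /andP[_ ->].
rewrite lerNl.
have neg f : (fun t => (-1) * f t + 0 * f t) = (fun t => - f t) :> (R -> R).
  by apply/funext => t; rewrite mulN1r mul0r addr0.
have CNW : is_C1 (fun t => - W t) (fun t => - dW t).
  by have := is_C1_lin (-1) 0 CW CW; rewrite !neg.
have bNE : bounded_measurable (fun t => - E t).
  by have := bounded_measurable_lin (-1) 0 bE bE; rewrite neg.
apply: (max_principle_upper (b := b) n1 l0 CNW bNE _ _ _ x01) => //.
- by move=> t /Ee; rewrite lerN2 ler_norml => /andP[].
- move=> y y01; have /andP[_ y1] := y01.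
  have bW := bounded_measurable_continuous (is_C1_continuous CW).
  have bk : bounded_measurable (fun t => lambda * (W t + E t)).
    apply: bounded_measurableM; first exact: bounded_measurable_cst.
    exact: bounded_measurableD.
  rewrite WE// opprD; congr (_ + _).
  transitivity ((-1) * cumul nu (fun t => lambda * (W t + E t)) y +
    0 * cumul nu (fun t => lambda * (W t + E t)) y); first by ring.
  by rewrite -cumul_lin//; apply: eq_cumul => // t _; ring.
- case: b bcW => -[] /=; first by move=> -> ->; rewrite oppr0.
  by rewrite !ler_norml !(lerNl _ eta) => /andP[-> _] /andP[-> _].
Qed.

End maximum_principle.

(** * Dependence of the solution on the measure *)

Section stability.
Context {R : realType}.
Implicit Types (g h k f df u du : R -> R) (x y z t a c e d M lambda eta : R).
Implicit Type nu mu : probability (measurableTypeR R) R.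

Lemma kernel_lipschitz x y t :
  `|below x t * (x - t) - below y t * (y - t)| <= `|x - y|.
Proof.
have xy := ler_norm (x - y); have yx : y - x <= `|x - y|.
  by rewrite distrC ler_norm.
rewrite /below; case: (leP t x) => tx; case: (leP t y) => ty;
  rewrite ?mul1r ?mul0r ler_norml; apply/andP; split; lra.
Qed.

Lemma kernel_lipschitzr x y z :
  `|below x y * (x - y) - below x z * (x - z)| <= `|y - z|.
Proof.
have yz := ler_norm (y - z); have zy : z - y <= `|y - z|.
  by rewrite distrC ler_norm.
rewrite /below; case: (leP y x) => tx; case: (leP z x) => ty;
  rewrite ?mul1r ?mul0r ler_norml; apply/andP; split; lra.
Qed.

Lemma within_continuous_kernel k x : {within `[0, 1], continuous k} ->
  {within `[0, 1], continuous (fun t => below x t * (x - t) * k t)}.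
Proof.
move=> ck y; apply: cvgM; last exact: ck.
move: y; apply/within_continuousP => y _ e e0; exists e => // z _ zy.
exact: le_lt_trans (kernel_lipschitzr x z y) zy.
Qed.

Lemma potential_lipschitz nu k M x y : on_unit_interval nu ->
  bounded_measurable k -> (forall t, 0 <= t <= 1 -> `|k t| <= M) ->
  `|potential nu k x - potential nu k y| <= M * `|x - y|.
Proof.
move=> n1 bk kM; have bker := @bounded_measurable_kernel R.
rewrite /potential -[X in X - _]mul1r -mulN1r -int_lin;
  try exact: bounded_measurableM.
rewrite -[leRHS](int_cst _ n1); apply: int_norm_le => //.
- by apply: bounded_measurable_lin; exact: bounded_measurableM.
- exact: bounded_measurable_cst.
move=> t t01; rewrite mul1r mulN1r -mulrBl normrM mulrC.
by rewrite ler_pM// ?kM// kernel_lipschitz.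
Qed.

(** Weak convergence gives pointwise convergence; the potentials are Lipschitz
    with a common constant, so a finite grid makes it uniform. *)
Lemma potential_cvg (mu_ : nat -> probability (measurableTypeR R) R) mu k eta :
  (forall n, on_unit_interval (mu_ n)) -> on_unit_interval mu ->
  converges_weakly mu_ mu -> {within `[0, 1], continuous k} -> 0 < eta ->
  \forall n \near \oo, forall x, 0 <= x <= 1 ->
    `|potential (mu_ n) k x - potential mu k x| <= eta.
Proof.
move=> mun1 mu1 muw ck eta0.
have bk := bounded_measurable_continuous ck; have [_ [M kM]] := bk.
have M0 : 0 <= M by apply: le_trans (kM 0 _); rewrite ?normr_ge0 ?lexx ?ler01.
have e3 : 0 < eta / 3 by rewrite divr_gt0.
have [N hN] : exists N, M / N.+1%:R <= eta / 3.
  have := truncnS_gt (M / (eta / 3)); set N := Num.truncn _ => hN.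
  exists N; rewrite ler_pdivrMr// mulrC -ler_pdivrMr//; exact: ltW.
have pt x : \forall n \near \oo,
    `|potential (mu_ n) k x - potential mu k x| <= eta / 3.
  have := muw _ (@within_continuous_kernel k x ck).
  move=> /cvgrPdist_le/(_ _ e3); apply: filterS => n; rewrite distrC.
  exact.
have grid : \forall n \near \oo, forall i : 'I_N.+2,
    `|potential (mu_ n) k (i%:R / N.+1%:R) - potential mu k (i%:R / N.+1%:R)|
      <= eta / 3.
  by apply: filter_forall => i; exact: pt.
apply: filterS grid => n grid x /andP[x0 x1].
have N0 : 0 < N.+1%:R :> R by rewrite ltr0n.
pose j := Num.truncn (x * N.+1%:R).
have /andP[j1 j2] : j%:R <= x * N.+1%:R < j.+1%:R.
  by apply: truncn_itv; rewrite mulr_ge0// ltW.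
have jN : (j < N.+2)%N.
  rewrite ltnS -(ler_nat R) (le_trans j1)// ler_piMl// ltW//.
have := grid (Ordinal jN); rewrite /=; set y := j%:R / N.+1%:R => hy.
have xy : `|x - y| <= N.+1%:R^-1.
  rewrite ger0_norm.
    by rewrite lerBlDr /y -[X in X + _]mul1r -mulrDl ler_pdivlMr// nat1r ltW.
  by rewrite subr_ge0 /y ler_pdivrMr.
have lip nu : on_unit_interval nu ->
    `|potential nu k x - potential nu k y| <= eta / 3.
  move=> n1; apply: le_trans (potential_lipschitz _ _ n1 bk kM) _.
  by apply: le_trans hN; rewrite ler_wpM2l.
have := lip _ (mun1 n); have := lip _ mu1; move: hy; rewrite !ler_norml.
by move=> /andP[? ?] /andP[? ?] /andP[? ?]; apply/andP; split; lra.
Qed.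

(** The difference of two solutions for different measures is controlled by the
    difference of the potentials of h. Subtracting the constant c from h makes
    the derivative of the difference of the potentials vanish at 1 in the
    Neumann case. *)
Lemma stability b mu nu lambda g f df u du c eta :
  on_unit_interval mu -> non_atomic mu ->
  on_unit_interval nu -> non_atomic nu ->
  0 < lambda -> {within `[0, 1], continuous g} ->
  solves mu lambda g f df -> boundary_condition b f df ->
  solves nu lambda g u du -> boundary_condition b u du ->
  let h t := lambda * f t - g t in
  match b with Neumann => c = \int[nu]_(t in `[0, 1]) h t
             | Dirichlet => c = 0 end -> `|c| <= eta ->
  (forall x, 0 <= x <= 1 -> `|potential nu h x - potential mu h x| <= eta) ->
  forall x, 0 <= x <= 1 -> `|u x - f x| <= (4 + lambda^-1) * eta.
Proof.
move=> mu1 mua n1 nua l0 cg sf bf su bu h hc ce he.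
have bg := bounded_measurable_continuous cg.
have bh : bounded_measurable h by exact: solves_bounded_measurable sf.
have bc := @bounded_measurable_cst R.
have [Cu Eu] := su; have [Cf Ef] := sf.
have bbu := bounded_measurable_continuous (is_C1_continuous Cu).
have bbf := bounded_measurable_continuous (is_C1_continuous Cf).
pose e x := 1 * (1 * potential nu h x + (- c) * potential nu (cst 1) x) +
   (-1) * potential mu h x.
pose de x := 1 * (1 * cumul nu h x + (- c) * cumul nu (cst 1) x) +
   (-1) * cumul mu h x.
have Ce : is_C1 e de.
  by apply: is_C1_lin; [apply: is_C1_lin|]; exact: potential_C1.
have be := bounded_measurable_continuous (is_C1_continuous Ce).
have e2 x : 0 <= x <= 1 -> `|e x| <= 2 * eta.
  move=> x01; have := he x x01.
  have : `|potential nu (cst 1) x| <= 1.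
    have := @potential_lipschitz nu (cst 1) 1 x 0 n1 (bc 1).
    rewrite potential0// !subr0 mul1r => h1; apply: le_trans (h1 _) _.
      by move=> t _; rewrite /= normr1.
    by have /andP[x0 x1] := x01; rewrite ger0_norm.
  move=> p1 p2; rewrite (_ : e x =
      (potential nu h x - potential mu h x) - c * potential nu (cst 1) x).
    rewrite (le_trans (ler_normB _ _))// mulr_natl mulr2n lerD// normrM.
    by rewrite -[leRHS]mulr1 ler_pM.
  by rewrite /e; ring.
have eta0 : 0 <= eta by exact: le_trans ce.
pose W x := 1 * (1 * u x + (-1) * f x) + (-1) * e x.
pose dW x := 1 * (1 * du x + (-1) * df x) + (-1) * de x.
have CW : is_C1 W dW by apply: is_C1_lin => //; exact: is_C1_lin.
(* The equation for W has density lambda (W + e) + c = lambda (W + E). *)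
pose E x := e x + c / lambda.
have bE : bounded_measurable E by exact: bounded_measurableD (bc _).
have Eeta x : 0 <= x <= 1 -> `|E x| <= (2 + lambda^-1) * eta.
  move=> x01; rewrite (le_trans (ler_normD _ _))// mulrDl lerD ?e2//.
  by rewrite normrM mulrC gtr0_norm ?invr_gt0// ler_wpM2l// invr_ge0 ltW.
have de0 : de 0 = 0 by rewrite /de !cumul0//; ring.
have WE x : 0 <= x <= 1 ->
    dW x = dW 0 + cumul nu (fun t => lambda * (W t + E t)) x.
  move=> x01; have /andP[_ x1] := x01.
  have -> : cumul nu (fun t => lambda * (W t + E t)) x =
      1 * cumul nu (fun t => lambda * u t - g t) x +
      (-1) * cumul nu (fun t => 1 * h t + (- c) * 1) x.
    rewrite -cumul_lin//; last 2 first.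
    - exact: solves_bounded_measurable su.
    - exact: (bounded_measurable_lin 1 (- c) bh (bc 1)).
    apply: eq_cumul => // t _; rewrite /W /E /h; field.
    by rewrite gt_eqF.
  rewrite (@cumul_lin _ nu h (cst 1))// /dW (Eu x)// (Ef x)// de0 /de -/h; ring.
have := @max_principle _ b nu lambda W dW E ((2 + lambda^-1) * eta) n1 l0 CW
  bE Eeta WE.
move=> mp x x01.
have Wx : `|W x| <= (2 + lambda^-1) * eta.
  apply: mp => //; case: b bf bu hc => -[] b0 b1 -[] a0 a1 hc.
    split; first by rewrite /dW de0 a0 b0; ring.
    rewrite /dW a1 b1 /de !cumul1 -/h -hc (int_cst _ n1).
    have i01 : 0 <= (1 : R) <= 1 by rewrite lexx ler01.
    have := Ef 1 i01; rewrite b0 b1 cumul1 add0r -/h => <-; ring.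
  split.
    rewrite (_ : W 0 = 0); last by rewrite /W a0 b0 /e !potential0//; ring.
    by rewrite normr0 mulr_ge0// addr_ge0// invr_ge0 ltW.
  rewrite /W a1 b1 !mulr0 addr0 mulr0 add0r mulN1r normrN.
  rewrite (le_trans (e2 1 _)) ?lexx ?ler01// ler_wpM2r// lerDl invr_ge0 ltW//.
have -> : u x - f x = W x + e x by rewrite /W; ring.
rewrite (le_trans (ler_normD _ _))//.
rewrite (_ : (4 + _) * eta = (2 + lambda^-1) * eta + 2 * eta); last by ring.
by rewrite lerD// e2.
Qed.

(** Uniform convergence of the solutions under weak convergence of the
    measures. *)
Lemma resolvent_cvg b (mu_ : nat -> probability (measurableTypeR R) R) mu
    lambda g f df (u_ du_ : nat -> R -> R) e :
  (forall n, on_unit_interval (mu_ n)) -> on_unit_interval mu ->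
  (forall n, non_atomic (mu_ n)) -> non_atomic mu ->
  converges_weakly mu_ mu -> 0 < lambda -> {within `[0, 1], continuous g} ->
  solves mu lambda g f df -> boundary_condition b f df ->
  (forall n, solves (mu_ n) lambda g (u_ n) (du_ n)) ->
  (forall n, boundary_condition b (u_ n) (du_ n)) -> 0 < e ->
  \forall n \near \oo, forall x, 0 <= x <= 1 -> `|u_ n x - f x| <= e.
Proof.
move=> mun1 mu1 muna mua muw l0 cg sf bf su bu e0.
have k0 : 0 < 4 + lambda^-1 by rewrite addr_gt0// invr_gt0.
pose eta := e / (4 + lambda^-1).
have eta0 : 0 < eta by rewrite divr_gt0.
pose h t := lambda * f t - g t.
have ch : {within `[0, 1], continuous h}.
  have := @within_continuous_lin R f g lambda (-1) (is_C1_continuous sf.1) cg.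
  rewrite (_ : (fun t => _) = h)//; apply/funext => t; by rewrite /h mulN1r.
have pot := potential_cvg mun1 mu1 muw ch eta0.
have int : \forall n \near \oo,
    b = Neumann -> `|\int[mu_ n]_(t in `[0, 1]) h t| <= eta.
  have := muw _ ch => /cvgrPdist_le/(_ _ eta0); apply: filterS => n + bN.
  rewrite bN in bf; have [b0 b1] := bf.
  have i01 : 0 <= (1 : R) <= 1 by rewrite lexx ler01.
  by have := sf.2 1 i01; rewrite b0 b1 add0r cumul1 -/h => <-;
    rewrite sub0r normrN.
apply: filterS2 pot int => n pot int x x01.
pose c := if b is Neumann then \int[mu_ n]_(t in `[0, 1]) h t else 0.
rewrite (_ : e = (4 + lambda^-1) * eta); last by rewrite mulrC divfK// gt_eqF.
apply: (@stability b mu (mu_ n) lambda g f df (u_ n) (du_ n) c) => //.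
- by rewrite /c; case: b {bf bu int c}.
- rewrite /c; case: b int {bf bu c} => [->//|_]; by rewrite normr0 ltW.
Qed.

End stability.

(** * Supports and functions linear on gaps *)

Section support.
Context {R : realType}.
Implicit Types (g h k f df u du : R -> R) (x y z t a c e d l r M lambda : R).
Implicit Type nu mu : probability (measurableTypeR R) R.

Lemma null_itv nu x : ~ supp nu x ->
  exists2 d, 0 < d & nu `](x - d)%R, (x + d)%R[%classic = 0%E.
Proof.
move=> nsx; apply: contrapT => nd; apply: nsx => U oU Ux.
rewrite lt_neqAle measure_ge0 andbT eq_sym; apply/eqP => U0.
have /nbhs_ballP[d d0 dU] : nbhs x U by exact: open_nbhs_nbhs.
apply: nd; exists d => //; apply/eqP; rewrite -measure_le0 -U0 -ball_itv.
apply: le_measure; rewrite ?inE//; apply: open_measurable => //.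
exact: ball_open.
Qed.

Lemma itv_nbhs x d : 0 < d -> open (`](x - d)%R, (x + d)%R[%classic : set R) /\
  `](x - d)%R, (x + d)%R[%classic x.
Proof.
move=> d0; split; first exact: itv_open.
by rewrite /= in_itv /= ltrBlDr ltrDl d0.
Qed.

Lemma supp_closed nu : closed (supp nu).
Proof.
rewrite -openC openE => x /= /null_itv[d /(itv_nbhs x)[od xd] n0].
apply: filterS (open_nbhs_nbhs (conj od xd)) => y xy sy.
by have := sy _ od xy; rewrite n0 ltxx.
Qed.

Lemma unit_interval_compl_null nu : on_unit_interval nu ->
  nu (~` `[0%R, 1%R]) = 0%E.
Proof.
move=> n1; rewrite probability_setC; last exact: measurable_itv.
by rewrite [X in (1 - X)%E]n1 subee.
Qed.

Lemma supp_unit nu x : on_unit_interval nu -> supp nu x -> 0 <= x <= 1.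
Proof.
move=> n1 sx; have : ~ (~` `[0, 1]%classic) x.
  move=> nx; have := sx _ _ nx; rewrite unit_interval_compl_null// ltxx => h.
  by suff /h : open (~` `[0, 1]%classic : set R) by [];
    exact/closed_openC/interval_closed.
by move=> /contrapT; rewrite /= in_itv.
Qed.

Lemma ae_eq_supp nu g h : on_unit_interval nu ->
  {within `[0, 1], continuous g} -> {within `[0, 1], continuous h} ->
  g = h %[ae nu] -> forall x, supp nu x -> g x = h x.
Proof.
move=> n1 cg ch [N [mN N0 gh]] x sx; apply/eqP/contraT => gx.
have x01 := supp_unit n1 sx.
have := @within_continuous_lin R g h 1 (-1) cg ch => /within_continuousP cD.
have e0 : 0 < `|g x - h x| by rewrite normr_gt0 subr_eq0.
have [d d0 hd] := cD x x01 _ e0.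
have [oI xI] := itv_nbhs x d0; have := sx _ oI xI.
suff -> : nu `](x - d)%R, (x + d)%R[%classic = 0%E by rewrite ltxx.
apply/eqP; rewrite -measure_le0.
have mC : measurable (~` `[0, 1]%classic : set (measurableTypeR R)).
  by apply: measurableC; exact: measurable_itv.
have sub : `](x - d)%R, (x + d)%R[%classic `<=` N `|` ~` `[0, 1]%classic.
  move=> y xy; have [y01|ny] := pselect (`[0, 1]%classic y); last by right.
  left; apply: gh => /= /(_ I) ghy.
  have := hd y; rewrite /= !in_itv /= in y01 xy => /(_ y01).
  by rewrite ltr_distl ghy !mul1r !mulN1r subrr sub0r normrN ltxx => /(_ xy).
apply: (@le_trans _ _ (nu (N `|` ~` `[0%R, 1%R]%classic))).
  by apply: le_measure; rewrite ?inE//; exact: measurableU.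
apply: le_trans (measureU2 _ _ _) _ => //.
by rewrite [X in (X + _)%E]N0 [X in (_ + X)%E](unit_interval_compl_null n1)
  adde0.
Qed.

(** A primitive is locally constant on a gap, hence constant. *)
Lemma cumul_gap nu k x y : on_unit_interval nu -> non_atomic nu ->
  bounded_measurable k -> 0 <= x -> x <= y -> y <= 1 ->
  (forall z, x <= z <= y -> ~ supp nu z) -> cumul nu k x = cumul nu k y.
Proof.
move=> n1 nua bk x0 xy y1 gap.
have [cc _] := potential_C1 n1 nua bk.
have [_ [M kM]] := bk.
have [z||z _ /eqP] := @MVT_segment R (cumul nu k) (cst 0) x y xy; last 2 first.
- by apply: continuous_subspaceW cc; apply: subset_itv; rewrite bnd_simp.
- by rewrite mul0r subr_eq0 => /eqP.
rewrite in_itv /= => /andP[xz zy].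
have [|d d0 nd] := @null_itv nu z; first by apply: gap; rewrite !ltW.
have z1 : z <= 1 by exact: le_trans (ltW zy) y1.
apply: (@near_eq_is_derive _ R R (cst (cumul nu k z))).
have xyz : z \in `]x, y[ by rewrite in_itv /= xz.
have := near_in_itvoo xyz; apply: filterS2 (nbhsx_ballx z d d0) => w zw.
rewrite in_itv /= => /andP[xw wy]; apply/eqP;
  rewrite eq_sym -subr_eq0 -normr_le0.
rewrite -(mulr0 M); apply: (@cumul_modulus _ nu k M z w d 0) => //.
- by apply: le_trans (kM 0 _); rewrite ?normr_ge0 ?lexx ?ler01.
- by rewrite (le_trans (ltW wy)).
- by rewrite distrC.
- by rewrite nd.
Qed.

(** The derivative of a solution is constant on a gap. *)
Lemma solves_linear_on_gaps nu lambda g u du : on_unit_interval nu ->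
  non_atomic nu -> bounded_measurable g -> solves nu lambda g u du ->
  linear_on_gaps nu u.
Proof.
move=> n1 nua bg su i gap; have [Cu Eu] := su.
have bk := solves_bounded_measurable bg su.
have [[x0 ix0]|] := pselect (exists x, x \in i); last first.
  by move=> ni; exists 0, 0 => x ix; exfalso; apply: ni; exists x.
have i01 x : x \in i -> 0 <= x <= 1.
  by move=> /gap[]; rewrite /= in_itv.
have itv x y z : x \in i -> y \in i -> x <= z <= y -> z \in i.
  by move=> ix iy xzy; apply: (interval_is_interval ix iy xzy).
have duE x y : x \in i -> y \in i -> x <= y -> du x = du y.
  move=> ix iy xy; have /andP[y0 y1] := i01 _ iy;
    have /andP[x0' x1] := i01 _ ix.
  rewrite (Eu x) ?i01// (Eu y) ?i01//; congr (_ + _).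
  apply: cumul_gap => // z xzy.
  by have /gap[] : [set` i] z by exact: itv xzy.
have uE x y : x \in i -> y \in i -> x < y -> u y - u x = du x0 * (y - x).
  move=> ix iy xy; have /andP[y0 y1] := i01 _ iy;
    have /andP[x0' x1] := i01 _ ix.
  have [z /andP[xz zy] ->] := is_C1_MVT Cu x0' xy y1.
  have iz : z \in i by apply: (itv x y) => //; rewrite !ltW.
  congr (_ * _); have [h|/ltW h] := leP z x0; first exact: duE.
  by apply/esym; exact: duE.
exists (du x0), (u x0 - du x0 * x0) => x ix.
have [h|h|->] := ltgtP x x0; last by ring.
- by have := uE _ _ ix ix0 h; lra.
- by have := uE _ _ ix0 ix h; lra.
Qed.

End support.

(** * Interpolation across the gaps of a closed set *)

Section gap_interpolation.
Context {R : realType} (K : set R).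
Hypotheses (Kclosed : closed K) (K0 : K 0) (K1 : K 1).
Implicit Types (g h u : R -> R) (x y z t a c e d l r M : R).
Implicit Type nu : probability (measurableTypeR R) R.

(** For x in the unit interval, the last point of K up to x: x itself when x is
    in K, and otherwise the left end of the gap around x. *)
Definition left_end x := sup [set z | K z /\ z <= x].

(** For x in the unit interval, the first point of K from x on. *)
Definition right_end x := inf [set z | K z /\ x <= z].

Lemma left_endP x : 0 <= x -> [/\ K (left_end x), left_end x <= x &
  forall z, K z -> z <= x -> z <= left_end x].
Proof.
move=> x0; rewrite /left_end; set A := [set z | _].
have A0 : A !=set0 by exists 0.
have ubA : has_ubound A by exists x => z [].
have Ax : sup A <= x by apply: ge_sup => // z [].
have Az z : K z -> z <= x -> z <= sup A by move=> Kz zx; apply: ub_le_sup.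
split=> //; apply: contrapT => nK.
have /nbhs_ballP[d d0 dK] : nbhs (sup A) (~` K).
  by apply: open_nbhs_nbhs; split=> //; exact: closed_openC.
have [|z [Kz zx] dz] := @sup_gt R A (sup A - d) A0;
  first by rewrite ltrBlDr ltrDl.
by apply: dK (Kz); rewrite /ball /= ger0_norm ?subr_ge0 ?Az// ltrBlDr -ltrBlDl.
Qed.

Lemma right_endP x : x <= 1 -> [/\ K (right_end x), x <= right_end x &
  forall z, K z -> x <= z -> right_end x <= z].
Proof.
move=> x1; rewrite /right_end; set A := [set z | _].
have A0 : A !=set0 by exists 1.
have lbA : has_lbound A by exists x => z [].
have Ax : x <= inf A by apply: lb_le_inf => // z [].
have Az z : K z -> x <= z -> inf A <= z by move=> Kz xz; apply: ge_inf.
split=> //; apply: contrapT => nK.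
have /nbhs_ballP[d d0 dK] : nbhs (inf A) (~` K).
  by apply: open_nbhs_nbhs; split=> //; exact: closed_openC.
have [|z [Kz zx] dz] := @inf_lt R A (inf A + d) A0; first by rewrite ltrDl.
by apply: dK (Kz); rewrite /ball /= distrC ger0_norm ?subr_ge0 ?Az// ltrBlDl.
Qed.

Lemma ends_unit x : 0 <= x <= 1 ->
  0 <= left_end x <= 1 /\ 0 <= right_end x <= 1.
Proof.
move=> /andP[x0 x1]; have [_ lx hl] := left_endP x0.
have [_ xr hr] := right_endP x1.
have := hl 0 K0 x0; have := hr 1 K1 x1.
by split; apply/andP; split; lra.
Qed.

Lemma left_end_id x : 0 <= x -> K x -> left_end x = x.
Proof.
move=> x0 Kx; have [_ lx hl] := left_endP x0.
by apply/eqP; rewrite eq_le lx hl.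
Qed.

Lemma left_end_gap x y : 0 <= x -> x <= y -> (forall z, x < z <= y -> ~ K z) ->
  left_end y = left_end x.
Proof.
move=> x0 xy gap; have [Kx lx hl] := left_endP x0.
have [Ky ly hl'] := left_endP (le_trans x0 xy).
apply/eqP; rewrite eq_le hl' ?(le_trans lx)// andbT hl//.
by rewrite leNgt; apply/negP => xly; apply: (gap (left_end y)) => //;
  rewrite xly.
Qed.

Lemma right_end_gap x y : y <= 1 -> x <= y -> (forall z, x <= z < y -> ~ K z) ->
  right_end y = right_end x.
Proof.
move=> y1 xy gap; have [Ky ry hr] := right_endP y1.
have [Kx rx hr'] := right_endP (le_trans xy y1).
apply/eqP; rewrite eq_le [X in _ && X]hr' ?(le_trans xy)// andbT hr//.
by rewrite leNgt; apply/negP => xly; apply: (gap (right_end x)) => //;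
  rewrite xly andbT.
Qed.

(** The function that agrees with g on K and is affine on each gap. At a point
    of K both ends are that point, and the quotient is 0 / 0 = 0. *)
Definition interpolate g x := g (left_end x) +
  (x - left_end x) / (right_end x - left_end x) *
    (g (right_end x) - g (left_end x)).

Lemma interpolate_id g x : 0 <= x -> K x -> interpolate g x = g x.
Proof.
by move=> x0 Kx; rewrite /interpolate left_end_id// subrr mul0r mul0r addr0.
Qed.

Let slope01 x : 0 <= x <= 1 ->
  0 <= (x - left_end x) / (right_end x - left_end x) <= 1.
Proof.
move=> /andP[x0 x1]; have [_ lx _] := left_endP x0.
have [_ xr _] := right_endP x1.
have [->|lr] := eqVneq (right_end x) (left_end x).
  by rewrite subrr invr0 mulr0 lexx ler01.
have : 0 < right_end x - left_end x.
  by rewrite subr_gt0 lt_neqAle eq_sym lr (le_trans lx).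
move=> d0; rewrite divr_ge0 ?subr_ge0// ?(ltW d0)//=; last exact: le_trans xr.
by rewrite ler_pdivrMr// mul1r lerD2r.
Qed.

(** Off K the interpolation is locally affine. At a point x of K and for y
    close to x, say on the right, the left end of y is in [x, y]; the right end
    is either close to x as well, or so far away that the slope on the gap is
    bounded. *)
Lemma interpolate_continuous g : {within `[0, 1], continuous g} ->
  {within `[0, 1], continuous (interpolate g)}.
Proof.
move=> cg; have [_ [M gM]] := bounded_measurable_continuous cg.
have M0 : 0 <= M by apply: le_trans (gM 0 _); rewrite ?normr_ge0 ?lexx ?ler01.
have gB p q : 0 <= p <= 1 -> 0 <= q <= 1 -> `|g p - g q| <= 2 * M.
  move=> p01 q01; rewrite (le_trans (ler_normB _ _))// mulr_natl mulr2n.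
  by rewrite lerD// gM.
move/within_continuousP : cg => cg; apply/within_continuousP => x x01 e e0.
have /andP[x0 x1] := x01; have [Kl lx hl] := left_endP x0.
have [Kr xr hr] := right_endP x1.
have M1 : 0 < 2 * M + 1 by rewrite ltr_pwDr// mulr_ge0.
have [Kx|nKx] := pselect (K x); last first.
  have lx' : left_end x < x by rewrite lt_neqAle lx andbT; apply/eqP => E;
    rewrite E in Kl.
  have xr' : x < right_end x by rewrite lt_neqAle xr andbT; apply/eqP => E;
    rewrite -E in Kr.
  set l := left_end x in Kl lx hl lx' *; set r := right_end x in Kr xr hr xr' *.
  have lr0 : 0 < r - l by rewrite subr_gt0 (lt_trans lx').
  exists (Num.min (Num.min (x - l) (r - x)) (e * (r - l) / (2 * M + 1))).
    by rewrite !lt_min !subr_gt0 lx' xr' divr_gt0// mulr_gt0.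
  move=> y y01; rewrite !lt_min => /andP[/andP[yl yr] ye].
  have ly : l < y by move: yl; rewrite ltr_norml; lra.
  have ry : y < r by move: yr; rewrite ltr_norml; lra.
  have /andP[y0 y1] := y01.
  have noK z : l < z -> z < r -> ~ K z.
    move=> lz zr Kz; have [zx|/ltW xz] := leP z x.
      by have := hl z Kz zx; rewrite leNgt lz.
    by have := hr z Kz xz; rewrite leNgt zr.
  have lE : left_end y = l.
    have [xy|/ltW yx] := leP x y.
      by apply: left_end_gap => // z /andP[xz zy]; apply: noK; lra.
    by apply/esym/left_end_gap => // z /andP[xz zy]; apply: noK; lra.
  have rE : right_end y = r.
    have [xy|/ltW yx] := leP x y.
      by apply: right_end_gap => // z /andP[xz zy]; apply: noK; lra.
    by apply/esym/right_end_gap => // z /andP[xz zy]; apply: noK; lra.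
  have [l01 r01] := ends_unit x01.
  rewrite /interpolate lE rE -/l -/r.
  rewrite [X in `|X| < _](_ : _ = (y - x) / (r - l) * (g r - g l));
    last by ring.
  rewrite !normrM normfV (ger0_norm (ltW lr0)) mulrAC ltr_pdivrMr//.
  apply: le_lt_trans (ler_wpM2l (normr_ge0 _) (gB _ _ r01 l01)) _.
  move: ye; rewrite ltr_pdivlMr// => ye; apply: le_lt_trans ye.
  by rewrite ler_wpM2l// lerDl.
rewrite [interpolate g x]interpolate_id//.
have e2 : 0 < e / 2 by rewrite divr_gt0.
have [d d0 hd] := cg x x01 _ e2.
pose rho := Num.min (d / 2) (d * e / (4 * (2 * M + 1))).
have rho0 : 0 < rho.
  by rewrite lt_min !divr_gt0 ?mulr_gt0.
exists rho => // y y01 yx.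
have /andP[y0 y1] := y01; have [Kyl ly hly] := left_endP y0.
have [Kyr yr hry] := right_endP y1; have [l01 r01] := ends_unit y01.
have [/andP[s0 s1]] := (slope01 y01).
rewrite /interpolate; set l := left_end y in Kyl ly hly l01 s0 s1 *.
set r := right_end y in Kyr yr hry r01 s0 s1 *.
set s := _ / _ in s0 s1 *.
have yd : `|y - x| < d / 2 by rewrite (lt_le_trans yx)// ge_min lexx.
have yd4 : `|y - x| * (4 * (2 * M + 1)) < d * e.
  by rewrite -ltr_pdivlMr ?mulr_gt0// (lt_le_trans yx)// ge_min lexx orbT.
move: yd; rewrite ltr_norml => /andP[yd1 yd2].
(* When both ends are close to x, the value is a convex combination of two
   values close to g x. *)
have both : `|l - x| < d -> `|r - x| < d -> `|g l + s * (g r - g l) - g x| < e.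
  move=> /(hd l l01) + /(hd r r01).
  rewrite [X in _ -> _ -> `|X| < _](_ : _ =
    (1 - s) * (g l - g x) + s * (g r - g x)); last by ring.
  rewrite !ltr_norml => /andP[? ?] /andP[? ?].
  by apply/andP; split; nra.
(* When the gap is long, y is so close to x that the affine term is small. *)
have far q : `|y - x| <= d / 2 -> d / 2 <= r - l -> 0 <= q -> q <= `|y - x| ->
    q / (r - l) * (2 * M) < e / 2.
  move=> _ drl q0 qyx; have rl0 : 0 < r - l by apply: lt_le_trans drl;
    rewrite divr_gt0.
  rewrite mulrAC ltr_pdivrMr//.
  have h1 : q * (2 * M) <= `|y - x| * (2 * M + 1).
    by rewrite ler_pM// ?mulr_ge0// lerDl.
  have h2 : e / 2 * (d / 2) <= e / 2 * (r - l) by rewrite ler_wpM2l// ltW.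
  lra.
have yxd : `|y - x| <= d / 2 by rewrite ltW// ltr_norml yd1.
have [xy|/ltW yx'] := leP x y.
  have xl : x <= l by exact: hly.
  have lxd : `|l - x| < d by rewrite ger0_norm ?subr_ge0//; lra.
  have [rd|rd] := ltP r (x + d).
    by apply: both => //; rewrite ger0_norm ?subr_ge0; lra.
  have := hd l l01 lxd => hl2.
  have := far (y - l) yxd _ _ _.
  rewrite subr_ge0 => /(_ _ ly) far1.
  rewrite [X in `|X| < _](_ : _ = (g l - g x) + s * (g r - g l)); last by ring.
  apply: le_lt_trans (ler_normD _ _) _; rewrite [e]splitr ltrD//.
  rewrite normrM (ger0_norm s0); apply: le_lt_trans (far1 _ _); last 2 first.
  - lra.
  - by rewrite ger0_norm ?subr_ge0//; lra.
  by rewrite ler_wpM2l// gB.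
have rx : r <= x by exact: hry.
have rxd : `|r - x| < d by rewrite distrC ger0_norm ?subr_ge0//; lra.
have [ld|ld] := ltP (x - d) l.
  by apply: both => //; rewrite distrC ger0_norm ?subr_ge0; lra.
have rl0 : 0 < r - l by lra.
have := hd r r01 rxd => hl2.
have := far (r - y) yxd _ _ _.
rewrite subr_ge0 => /(_ _ yr) far1.
have sE : 1 - s = (r - y) / (r - l).
  by rewrite /s; field; rewrite gt_eqF.
rewrite [X in `|X| < _](_ : _ = (g r - g x) + (1 - s) * (g l - g r));
  last by ring.
apply: le_lt_trans (ler_normD _ _) _; rewrite [e]splitr ltrD//.
rewrite normrM ger0_norm ?subr_ge0// sE; apply: le_lt_trans (far1 _ _);
  last 2 first.
- lra.
- by rewrite distrC ger0_norm ?subr_ge0//; lra.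
by rewrite -sE ler_wpM2l ?subr_ge0// gB.
Qed.

Lemma interpolate_linear g (i : interval R) :
  [set` i] `<=` `[0, 1]%classic `\` K ->
  exists a c, forall x, x \in i -> interpolate g x = a * x + c.
Proof.
move=> gap; have [[p ip]|] := pselect (exists x, x \in i); last first.
  by move=> ni; exists 0, 0 => x ix; exfalso; apply: ni; exists x.
have i01 x : x \in i -> 0 <= x <= 1 by move=> /gap[]; rewrite /= in_itv.
have noK x y z : x \in i -> y \in i -> x <= z <= y -> ~ K z.
  by move=> ix iy xzy; have /gap[] := interval_is_interval ix iy xzy.
have ends x y : x \in i -> y \in i -> x <= y ->
    left_end y = left_end x /\ right_end y = right_end x.
  move=> ix iy xy; have /andP[x0 x1] := i01 _ ix; have /andP[y0 y1] := i01 _ iy.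
  split; [apply: left_end_gap|apply: right_end_gap] => // z /andP[xz zy];
    by apply: (noK x y) => //; rewrite ?xz ?zy ?ltW.
have endsp x : x \in i -> left_end x = left_end p /\ right_end x = right_end p.
  move=> ix; have [h|/ltW h] := leP p x; first exact: ends.
  by have [-> ->] := ends _ _ ix ip h.
set l := left_end p in endsp; set r := right_end p in endsp.
exists ((g r - g l) / (r - l)), (g l - l * ((g r - g l) / (r - l))) => x ix.
by have [lE rE] := endsp _ ix; rewrite /interpolate lE rE; ring.
Qed.

(** On a gap the difference D of the two functions is affine and vanishes at
    both ends: its slope, computed on both sides of x, must be 0. *)
Lemma gap_unique g h :
  {within `[0, 1], continuous g} -> {within `[0, 1], continuous h} ->
  (forall i : interval R, [set` i] `<=` `[0, 1]%classic `\` K ->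
    exists a c, forall x, x \in i -> g x = a * x + c) ->
  (forall i : interval R, [set` i] `<=` `[0, 1]%classic `\` K ->
    exists a c, forall x, x \in i -> h x = a * x + c) ->
  (forall x, K x -> g x = h x) -> forall x, 0 <= x <= 1 -> g x = h x.
Proof.
move=> cg ch lg lh gh x x01; have [/gh//|nKx] := pselect (K x).
have /andP[x0 x1] := x01; have [Kl lx hl] := left_endP x0.
have [Kr xr hr] := right_endP x1.
have lx' : left_end x < x by rewrite lt_neqAle lx andbT; apply/eqP => E;
  rewrite E in Kl.
have xr' : x < right_end x by rewrite lt_neqAle xr andbT; apply/eqP => E;
  rewrite -E in Kr.
have [/andP[l0 l1] /andP[r0 r1]] := ends_unit x01.
set l := left_end x in Kl lx hl lx' l0 l1;
  set r := right_end x in Kr xr hr xr' r0 r1.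
have gap : [set` `]l, r[] `<=` `[0, 1]%classic `\` K.
  move=> z; rewrite /= !in_itv /= => /andP[lz zr].
  split; first by apply/andP; split; lra.
  move=> Kz; have [zx|/ltW xz] := leP z x.
    by have := hl z Kz zx; rewrite leNgt lz.
  by have := hr z Kz xz; rewrite leNgt zr.
have [a [c gE]] := lg _ gap; have [a' [c' hE]] := lh _ gap.
pose D z := 1 * g z + (-1) * h z.
have cD : {within `[0, 1], continuous D} by exact: within_continuous_lin.
have D0 z : K z -> D z = 0 by move=> /gh; rewrite /D => ->; ring.
have DM p q : l <= p -> p < q -> q <= r -> D q - D p = (a - a') * (q - p).
  move=> lp pq qr.
  have [z||z _ ->//] := @MVT R D (cst (a - a')) p q pq; last first.
    apply: continuous_subspaceW cD; apply: subset_itv; rewrite bnd_simp; lra.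
  rewrite in_itv /= => /andP[pz zq].
  apply: (@near_eq_is_derive _ R R (fun w => (a - a') * w + (c - c'))).
    have : z \in `]l, r[ by rewrite in_itv /=; apply/andP; split; lra.
    by move=> /near_in_itvoo; apply: filterS => w iw; rewrite /D gE// hE//;
      ring.
  by apply: is_derive_eq; rewrite addr0 [LHS]mulr1.
have := DM l x (lexx l) lx' xr; have := DM x r lx xr' (lexx r).
rewrite (D0 r)// (D0 l)// => h1 h2; have aa : a - a' = 0 by nra.
by move: h1; rewrite aa mul0r /D; lra.
Qed.

End gap_interpolation.

(** * Equivalence classes and resolvents *)

Section classes.
Context {R : realType}.
Implicit Types (g h u du : R -> R) (x y t a c e d M lambda : R).
Implicit Type nu mu : probability (measurableTypeR R) R.

(** The complement of the support is a countable union of null intervals with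
    rational ends. *)
Lemma supp_ae nu : {ae nu, forall x : measurableTypeR R, supp nu x}.
Proof.
pose F n : set (measurableTypeR R) :=
  if unpickle n is Some pq then
    let I := `](ratr pq.1), (ratr (pq.2 : rat))[%classic in
    if nu I == 0%E then I else set0 else set0.
have F0 n : nu.-negligible (F n).
  rewrite /F; case: (unpickle n) => [pq|]; last exact: negligible_set0.
  case: eqP => [n0|_]; last exact: negligible_set0.
  exists (`](ratr pq.1), (ratr pq.2)[%classic : set R); split=> //.
apply: negligibleS (negligible_bigcup F0) => x /= /null_itv[d d0 nd].
have [p] := @rat_in_itvoo R (x - d) x ltac:(by rewrite ltrBlDr ltrDl).
rewrite in_itv /= => /andP[dp px].
have [q] := @rat_in_itvoo R x (x + d) ltac:(by rewrite ltrDl).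
rewrite in_itv /= => /andP[xq qd].
exists (pickle (p, q)); first exact: I.
rewrite /F pickleK /=.
rewrite (_ : (nu _ == 0%E) = true); first by rewrite /= in_itv /= px.
apply/eqP; apply/eqP; rewrite -measure_le0 -nd; apply: le_measure;
  rewrite ?inE//.
by move=> y; rewrite /= !in_itv /= => /andP[py yq]; apply/andP; split; lra.
Qed.

Lemma unit_interval_ae nu : on_unit_interval nu ->
  {ae nu, forall x : measurableTypeR R, 0 <= (x : R) <= 1}.
Proof.
move=> n1; exists (~` `[0, 1]%classic); split.
- by apply: measurableC; exact: measurable_itv.
- exact: unit_interval_compl_null.
- by move=> x /=; rewrite in_itv.
Qed.

(** The point ranges over the measurable type, which lets the filter lemmas
    combine this fact with other almost everywhere facts. *)
Lemma ae_eqE nu g h : g = h %[ae nu] ->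
  {ae nu, forall x : measurableTypeR R, g x = h x}.
Proof.
move=> [N [mN N0 gh]]; exists N; split=> // x nx; apply: gh => /= gx.
by apply: nx; exact: gx.
Qed.

(** A function continuous on the unit interval has a class, being equal almost
    everywhere to its extension by 0, which is bounded and Borel. *)
Lemma L2_class_continuous nu g : on_unit_interval nu ->
  {within `[0, 1], continuous g} -> (L2_class nu g : R -> R) = g %[ae nu].
Proof.
move=> n1 cg; have [mg [M gM]] := bounded_measurable_continuous cg.
have M0 : 0 <= M by apply: le_trans (gM 0 _); rewrite ?normr_ge0 ?lexx ?ler01.
pose gc := g \_ `[0, 1]%classic.
have gcE : gc = g %[ae nu].
  apply: filterS (unit_interval_ae n1) => x x01 _.
  by rewrite /gc /patch mem_setE in_itv /= x01.
have lgc : gc \in Lfun nu 2%:R%:E.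
  apply: (@Lfun_subset _ _ _ nu 2%:R%:E +oo%E) => //.
  - exact: lee1n.
  - by rewrite leey.
  - by apply: fin_num_measure.
  - by rewrite leey.
  apply/andP; rewrite !inE; split.
    have [+ _] := measurable_restrictT
      (g : measurableTypeR R -> measurableTypeR R) (measurable_itv `[0, 1]).
    by apply.
  rewrite /finite_norm unlock /=; case: ifP => [_|_]; last exact: ltry.
  apply: le_lt_trans (ltry M); apply/ess_sup_inf.ess_supP.
  apply: aeW => x /=; rewrite lee_fin /gc /patch mem_setE in_itv /=.
  by case: ifP => [x01|_]; [exact: gM|rewrite normr0].
apply: L2_classE; exists (L2_class nu gc).
by apply: ae_eq_trans gcE; exact: L2_classP.
Qed.

Lemma ae_eq_cumul nu (v : L2 nu) k x : bounded_measurable k -> x <= 1 ->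
  (v : R -> R) = k %[ae nu] ->
  \int[nu]_(t in `[0, x]) v t = cumul nu k x.
Proof.
move=> [mk _] x1 vk; congr fine; apply: ae_eq_integral => //.
- apply/measurable_EFinP; apply: measurable_funTS.
  by have /andP[] := L2_Lfun v; rewrite inE.
- apply/measurable_EFinP; apply: measurable_funS mk => //.
  by apply: subset_itvl; rewrite bnd_simp.
- by apply: filterS (ae_eqE vk) => t h _; congr (_%:E); exact: h.
Qed.

(** The resolvent has a C1 representative that solves the boundary value
    problem; existence of a solution shows that the set in the definition of
    the resolvent is inhabited. *)
Lemma resolventP b nu lambda (f : L2 nu) g : on_unit_interval nu ->
  non_atomic nu -> 0 < lambda -> {within `[0, 1], continuous g} ->
  (f : R -> R) = g %[ae nu] ->
  exists u du, [/\ solves nu lambda g u du, boundary_condition b u du &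
    (resolvent b lambda f : R -> R) = u %[ae nu]].
Proof.
move=> n1 nua l0 cg fg; have bg := bounded_measurable_continuous cg.
have [v Dwv wv] : [set w : L2 nu | exists2 v, Delta b w v &
     L2_sub (L2_scale lambda w) v = f] (resolvent b lambda f).
  apply: xgetPex.
  have [u [du [su bu]]] := solution_exists b n1 nua l0 bg.
  have [Cu Eu] := su; have cu := is_C1_continuous Cu.
  pose k t := lambda * u t - g t.
  have ck : {within `[0, 1], continuous k}.
    have := @within_continuous_lin R u g lambda (-1) cu cg.
    by rewrite (_ : (fun t => _) = k)//; apply/funext => t; rewrite /k mulN1r.
  have wu := L2_class_continuous n1 cu; have vk := L2_class_continuous n1 ck.
  exists (L2_class nu u); exists (L2_class nu k).
    exists u, du; split=> //; split=> // x; rewrite in_itv /= => x01.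
    rewrite Eu//; congr (_ + _); apply/esym; apply: ae_eq_cumul => //.
      exact: bounded_measurable_continuous.
    by case/andP: x01.
  apply/L2_eqP; apply: ae_eq_trans (L2_subE _ _) _.
  have wv : (fun x => L2_scale lambda (L2_class nu u) x - L2_class nu k x) =
      (fun x => lambda * u x - k x) %[ae nu].
    apply: filterS3 (ae_eqE (L2_scaleE lambda (L2_class nu u))) (ae_eqE wu)
      (ae_eqE vk).
    by move=> x sx wx vx _; rewrite sx// wx// vx.
  apply: ae_eq_trans wv _; apply: filterS (ae_eqE fg) => x fx _.
  by rewrite fx// /k; ring.
have [u [du [wu [Cu Eu] bu]]] := Dwv.
exists u, du; split=> //.
have bk : bounded_measurable (fun t => lambda * u t - g t).
  rewrite (_ : (fun t => _) = fun t => lambda * u t + (-1) * g t).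
    apply: bounded_measurable_lin => //.
    by apply: bounded_measurable_continuous; exact: is_C1_continuous Cu.
  by apply/funext => t; rewrite mulN1r.
split=> // x x01; rewrite Eu ?in_itv//; congr (_ + _).
apply: ae_eq_cumul => //; first by case/andP: x01.
have := L2_subE (L2_scale lambda (resolvent b lambda f)) v; rewrite wv => fE.
apply: filterS2 (filterI (ae_eqE fg) (ae_eqE wu)) (filterI (ae_eqE fE)
  (ae_eqE (L2_scaleE lambda (resolvent b lambda f)))) => t [ft ut] [st ct] _.
by rewrite -ft// st// ct// ut//; ring.
Qed.

End classes.

(** * Gap-linear representatives and the norm *)

Section gap_linear_representatives.
Context {R : realType}.
Implicit Types (g h u du : R -> R) (nu : probability (measurableTypeR R) R).

Lemma gap_linear_repP nu (f : L2 nu) g : on_unit_interval nu ->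
  supp nu 0 -> supp nu 1 -> continuous_rep f g ->
  continuous_rep f (gap_linear_rep f) /\ linear_on_gaps nu (gap_linear_rep f).
Proof.
move=> n1 s0 s1 [cg fg].
suff : (continuous_rep f `&` [set g | linear_on_gaps nu g]) (gap_linear_rep f)
  by [].
apply: xgetPex; exists (interpolate (supp nu) g); split; last first.
  by move=> i; apply: interpolate_linear => //; exact: supp_closed.
split; first by apply: interpolate_continuous => //; exact: supp_closed.
suff : (f : R -> R) = interpolate (supp nu) g %[ae nu] by [].
apply: filterS2 (ae_eqE fg) (supp_ae nu) => x fx sx _.
rewrite fx// interpolate_id//; first exact: supp_closed.
by have /andP[] := supp_unit n1 sx.
Qed.

Lemma gap_linear_rep_unique nu (f : L2 nu) g : on_unit_interval nu ->
  supp nu 0 -> supp nu 1 -> continuous_rep f g -> linear_on_gaps nu g ->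
  forall x, 0 <= x <= 1 -> gap_linear_rep f x = g x.
Proof.
move=> n1 s0 s1 fg lg.
have [[ch fh] lh] := gap_linear_repP n1 s0 s1 fg; have [cg fgE] := fg.
apply: (gap_unique (@supp_closed _ nu) s0 s1) => //.
apply: (ae_eq_supp n1) => //.
exact: ae_eq_trans (ae_eq_sym fh) fgE.
Qed.

Lemma Cnorm_le nu b (u : L2 nu) g e : on_unit_interval nu -> supp nu 0 ->
  {within `[0, 1], continuous g} -> (u : R -> R) = g %[ae nu] ->
  (b = Dirichlet -> g 0 = 0 /\ g 1 = 0) ->
  (forall x, 0 <= x <= 1 -> `|g x| <= e) ->
  (0 <= Cnorm b u <= e%:E)%E.
Proof.
move=> n1 s0 cg ug bg ge.
have Cu : u \in Cspace b nu by rewrite inE; exists g.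
rewrite /Cnorm Cu; set h := xget _ _.
have [ch uh] : continuous_rep u h by apply: xgetPex; exists g.
have hg x : supp nu x -> h x = g x.
  by apply: (ae_eq_supp n1) => //; exact: ae_eq_trans (ae_eq_sym uh) ug.
apply/andP; split.
  apply: le_trans (ereal_sup_ubound _); last first.
    by exists 0; [exact: s0|reflexivity].
  by rewrite lee_fin.
apply: ge_ereal_sup => _ [x sx <-]; rewrite lee_fin hg//.
by apply: ge; exact: supp_unit sx.
Qed.

End gap_linear_representatives.

Theorem theorem5p4 (R : realType) (b : boundary)
    (mu : probability (measurableTypeR R) R)
    (mu_ : nat -> probability (measurableTypeR R) R)
    (mu_on : on_unit_interval mu) (mu_na : non_atomic mu)
    (mu_0 : supp mu 0) (mu_1 : supp mu 1)
    (mun_on : forall n, on_unit_interval (mu_ n))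
    (mun_na : forall n, non_atomic (mu_ n))
    (mun_0 : forall n, supp (mu_ n) 0) (mun_1 : forall n, supp (mu_ n) 1)
    (mun_supp : forall n, supp mu `<=` supp (mu_ n))
    (mun_cvg : converges_weakly mu_ mu)
    (lambda : R) (lambda_gt0 : 0 < lambda)
    (f : L2 mu) (Cf : f \in Cspace b mu) :
  Cnorm b (L2_sub (resolvent b lambda (embedding (mu_ n) f))
                  (embedding (mu_ n) (resolvent b lambda f)))
    @[n --> \oo] --> 0%E.
Proof.
have [g0 g0f _] : exists2 g, continuous_rep f g &
    b = Dirichlet -> g 0 = 0 /\ g 1 = 0.
  by move: Cf; rewrite inE.
have [[cg fg] _] := gap_linear_repP mu_on mu_0 mu_1 g0f.
set g := gap_linear_rep f in cg fg.
have bg := bounded_measurable_continuous cg.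
have [u [du [su bu ru]]] := resolventP b mu_on mu_na lambda_gt0 cg fg.
have cu := is_C1_continuous su.1.
have uE := gap_linear_rep_unique mu_on mu_0 mu_1 (conj cu ru)
  (solves_linear_on_gaps mu_on mu_na bg su).
have emb n : (embedding (mu_ n) f : R -> R) = g %[ae mu_ n].
  exact: L2_class_continuous.
have emb_u n :
    (embedding (mu_ n) (resolvent b lambda f) : R -> R) = u %[ae mu_ n].
  have [[ch _] _] := gap_linear_repP mu_on mu_0 mu_1 (conj cu ru).
  apply: ae_eq_trans (L2_class_continuous (mun_on n) ch) _.
  by apply: filterS (unit_interval_ae (mun_on n)) => x x01 _; exact: uE.
have /choice[w_ hw] : forall n, exists w : (R -> R) * (R -> R),
    [/\ solves (mu_ n) lambda g w.1 w.2, boundary_condition b w.1 w.2 &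
    (resolvent b lambda (embedding (mu_ n) f) : R -> R) = w.1 %[ae mu_ n]].
  move=> n; have [w [dw [? ? ?]]] :=
    resolventP b (mun_on n) (mun_na n) lambda_gt0 cg (emb n).
  by exists (w, dw).
pose N n := Cnorm b (L2_sub (resolvent b lambda (embedding (mu_ n) f))
                  (embedding (mu_ n) (resolvent b lambda f))).
have small e : 0 < e -> \forall n \near \oo, (0 <= N n <= e%:E)%E.
  move=> e0.
  have := @resolvent_cvg R b mu_ mu lambda g u du (fun n => (w_ n).1)
    (fun n => (w_ n).2) e mun_on mu_on mun_na mu_na mun_cvg lambda_gt0 cg su bu.
  have sw n : solves (mu_ n) lambda g (w_ n).1 (w_ n).2 by have [] := hw n.
  have bw n : boundary_condition b (w_ n).1 (w_ n).2 by have [] := hw n.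
  move=> /(_ sw bw e0); apply: filterS => n wu.
  apply: (@Cnorm_le _ _ _ _ (fun x => (w_ n).1 x - u x)) => //.
  - have := @within_continuous_lin R (w_ n).1 u 1 (-1)
      (is_C1_continuous (sw n).1) cu.
    rewrite (_ : (fun x => _) = (fun x => (w_ n).1 x - u x))//.
    by apply/funext => x; rewrite mul1r mulN1r.
  - apply: ae_eq_trans (L2_subE _ _) _; have [_ _ rw] := hw n.
    by apply: filterS2 (ae_eqE rw) (ae_eqE (emb_u n)) => x wx ux _;
      rewrite wx// ux.
  - move=> bD; have := bw n; rewrite bD in bu *; have [u0 u1] := bu.
    by move=> [-> ->]; rewrite u0 u1 !subrr.
apply/fine_cvgP; split.
  apply: filterS (small 1 ltr01) => n /andP[N0 N1].
  by rewrite ge0_fin_numE// (le_lt_trans N1)// ltry.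
apply/cvgrPdist_le => e e0; apply: filterS (small e e0) => n /andP[N0 N1].
rewrite sub0r normrN ger0_norm; last exact: fine_ge0.
by rewrite -lee_fin fineK// ge0_fin_numE// (le_lt_trans N1)// ltry.
Qed.
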